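(* Let $\Gamma$ be a connected quasi-transitive graph without dominated ends. Then the following statements are equivalent: (i) $\Gamma$ is two-ended. (ii) $\Gamma$ can be split as a strongly thin tree-amalgamation $\bar\Gamma \ast_T \bar\Gamma$ (both factors being copies of one graph $\bar\Gamma$) that fulfils the following properties: (a) $\bar\Gamma$ is a connected rayless graph of finite diameter; (b) the identifying maps are all the identity; (c) all adhesions of the tree-amalgamation contained in $\bar\Gamma$ are finite and connected and pairwise disjoint. (iii) $\Gamma$ is quasi-isometric to the double ray.
   Context: Graphs are not assumed locally finite. A graph is quasi-transitive if its automorphism group has finitely many orbits on the vertex set. A ray is a one-way infinite path, a double ray is a two-way infinite path; a graph is rayless if it contains no ray. An end is an equivalence class of rays, two rays being equivalent if there is no finite vertex set $S$ such that they have tails in different components of $\Gamma\setminus S$. A graph is two-ended if it has exactly two ends. For a finite vertex set $S$ and an end $\omega$, $C(S,\omega)$ denotes the component of $\Gamma\setminus S$ containing tails of the rays of $\omega$. A vertex $v$ dominates an end $\omega$ if there is no finite vertex set $S$ not containing $v$ with $v\notin C(S,\omega)$; an end is dominated if some vertex dominates it. Tree-amalgamation over a double ray $T$: let $\{V_1,V_2\}$ be the canonical bipartition of $V(T)$. Let $c$ assign to each edge of $T$ a pair $(k,\ell)$ with $k,\ell\in\{0,1\}$ such that for every $v\in V_1$ the first coordinates of the labels of the two edges at $v$ are distinct (so take both values), and for every $v\in V_2$ the second coordinates of the labels of the two edges at $v$ are distinct. Let $\Gamma_1,\Gamma_2$ be graphs with families $\{S_0,S_1\}$ of subsets of $V(\Gamma_1)$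 and $\{T_0,T_1\}$ of subsets of $V(\Gamma_2)$, all of the same cardinality, and bijections $\phi_{k\ell}\colon S_k\to T_\ell$ (the identifying maps). For each $v\in V_i$ take a copy $\Gamma_i^v$ of $\Gamma_i$ with corresponding copies $S_k^v$ (if $i=1$) or $T_\ell^v$ (if $i=2$). In the disjoint union of all these copies, for every edge $st$ of $T$ with $s\in V_1$, $t\in V_2$, $c(st)=(k,\ell)$, identify each $x\in S_k^s$ with $\phi_{k\ell}(x)\in T_\ell^t$. The resulting graph is the tree-amalgamation $\Gamma_1\ast_T\Gamma_2$. The sets $S_k,T_\ell$ are its adhesions (sets of adhesion); an adhesion is connected if it induces a connected subgraph. The tree-amalgamation is thin if all adhesions are finite and $T$ is the double ray, and strongly thin if moreover $\Gamma_1$ and $\Gamma_2$ are rayless. ''$\Gamma$ can be split as'' such an amalgamation means $\Gamma$ is isomorphic to it. In (b), the copies of $\bar\Gamma$ are regarded as subgraphs of $\Gamma$: two adhesion sets glued along an edge of $T$ are one and the same vertex subset of $\Gamma$, and they are identified by the identity of that set. A map $\phi\colon X\to Y$ of metric spaces is a quasi-isometry if there is $\lambda\ge 1$ with $\frac1\lambda d_X(x,x')-\lambda\le d_Y(\phi(x),\phi(x'))\le\lambda d_X(x,x')+\lambda$ for all $x,x'\in X$, and there is $\lambda'$ such that every $y\in Y$ is at distance at most $\lambda'$ from $\phi(X)$. Connected graphs carry the graph metric on their vertex sets. *)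

(* Defs.v *)
From HB Require Import structures.
From mathcomp Require Import all_boot all_order all_algebra.
From mathcomp Require Import boolp classical_sets functions cardinality reals.
From Stdlib Require Import Relation_Operators.

Set Implicit Arguments.
Unset Strict Implicit.
Unset Printing Implicit Defensive.

Import Order.TTheory GRing.Theory Num.Theory.
Local Open Scope classical_set_scope.
Local Open Scope card_scope.
Local Open Scope ring_scope.

(** * Graphs *)

(* Simple graphs on an arbitrary vertex type: neither finite nor locally
   finite.  [adj] is boolean only to be usable with [path]; classically this
   is no restriction. *)
Record graph := Graph {
  vert :> Type;
  adj : rel vert;
  adj_sym : symmetric adj;
  adj_irr : irreflexive adj }.

Definition is_iso (G H : graph) (f : G -> H) :=
  bijective f /\ forall x y, adj (f x) (f y) = adj x y.

Definition aut_orbit (G : graph) (x : G) : set G :=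
  [set y | exists2 f : G -> G, is_iso f & f x = y].

Definition quasi_transitive (G : graph) := finite_set (range (@aut_orbit G)).

(* [x :: p] is a walk from [x] to [y] *)
Definition walk (G : graph) (x y : G) (p : seq G) :=
  path (@adj G) x p /\ last x p = y.

Definition joined_in (G : graph) (A : set G) (x y : G) :=
  exists2 p, walk x y p & all (mem A) (x :: p).

(* [A] induces a connected subgraph; the empty graph is not connected *)
Definition connected_set (G : graph) (A : set G) :=
  A !=set0 /\ forall x y, A x -> A y -> joined_in A x y.

Definition connected_graph (G : graph) := connected_set [set: G].

(* the component of [G \ S] containing [x], for [x] outside [S] *)
Definition component_of (G : graph) (S : set G) (x : G) : set G :=
  [set y | joined_in (~` S) x y].

Definition is_component (G : graph) (S C : set G) :=
  exists2 x, ~ S x & C = component_of S x.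

(** * Rays and ends *)

Definition is_ray (G : graph) (r : nat -> G) :=
  injective r /\ forall n, adj (r n) (r n.+1).

Definition rayless (G : graph) := forall r : nat -> G, ~ is_ray r.

Definition has_tail_in (G : graph) (r : nat -> G) (C : set G) :=
  exists N, forall n, (N <= n)%N -> C (r n).

Definition separates_rays (G : graph) (S : set G) (r r' : nat -> G) :=
  exists C C', [/\ is_component S C, is_component S C', C <> C',
                   has_tail_in r C & has_tail_in r' C'].

Definition ray_equiv (G : graph) (r r' : nat -> G) :=
  ~ exists2 S, finite_set S & separates_rays S r r'.

Definition ends (G : graph) : set (set (nat -> G)) :=
  [set w | exists2 r, is_ray r & w = [set r' | is_ray r' /\ ray_equiv r r']].

Arguments ends : clear implicits.

Definition two_ended (G : graph) := ends G #= `I_2.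

(* C(S, w); for finite [S] there is exactly one component [C] as below *)
Definition end_component (G : graph) (S : set G) (w : set (nat -> G)) : set G :=
  [set v | exists C, [/\ is_component S C,
                         forall r, w r -> has_tail_in r C & C v]].

Definition dominates (G : graph) (v : G) (w : set (nat -> G)) :=
  ~ exists S, [/\ finite_set S, ~ S v & ~ end_component S w v].

Definition no_dominated_end (G : graph) :=
  forall w, ends G w -> ~ exists v, dominates v w.

(** * The graph metric and quasi-isometries *)

(* The default value 0 is only used for vertices in different components. *)
Definition gdist (G : graph) (x y : G) : nat :=
  xget 0%N [set n | (exists2 p, walk x y p & size p = n) /\
                    (forall p, walk x y p -> (n <= size p)%N)].

Definition finite_diameter (G : graph) :=
  exists n, forall x y : G, (gdist x y <= n)%N.

Definition quasi_isometry (R : realType) (X Y : Type)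
    (dX : X -> X -> R) (dY : Y -> Y -> R) (f : X -> Y) :=
  (exists2 l : R, 1 <= l & forall x x',
     l^-1 * dX x x' - l <= dY (f x) (f x') <= l * dX x x' + l) /\
  (exists l' : R, forall y, exists x, dY y (f x) <= l').

Definition quasi_isometric (R : realType) (G H : graph) :=
  exists f : G -> H, quasi_isometry (fun x x' : G => (gdist x x')%:R : R)
                                    (fun y y' : H => (gdist y y')%:R : R) f.

(** * The double ray *)

Definition dray_adj : rel int := fun i j => `|i - j|%N == 1%N.

Lemma dray_adj_sym : symmetric dray_adj.
Proof. by move=> i j; rewrite /dray_adj distnC. Qed.

Lemma dray_adj_irr : irreflexive dray_adj.
Proof. by move=> i; rewrite /dray_adj subrr. Qed.

Definition double_ray : graph := Graph dray_adj_sym dray_adj_irr.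

(* The canonical bipartition of the double ray.  Its two classes are exchanged
   by an automorphism, so nothing is lost by fixing which one is [V1]. *)
Definition V1 := {s : double_ray | ~~ odd `|s|%N}.
Definition V2 := {t : double_ray | odd `|t|%N}.

(** * Tree-amalgamations over the double ray *)

(* The indices 0, 1 are [false], [true].  [lbl s t] is the label (k, l) of the
   edge [st]; its values on non-adjacent pairs are irrelevant, as are the
   values of [idmap k l] outside [adh1 k].  That all adhesions have the same
   cardinality is a consequence of [idmap_bij]. *)
Record amalgam_data (G1 G2 : graph) := AmalgamData {
  lbl : V1 -> V2 -> bool * bool;
  lbl_V1 : forall (s : V1) (t t' : V2), adj (sval s) (sval t) ->
    adj (sval s) (sval t') -> t <> t' -> (lbl s t).1 <> (lbl s t').1;
  lbl_V2 : forall (t : V2) (s s' : V1), adj (sval s) (sval t) ->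
    adj (sval s') (sval t) -> s <> s' -> (lbl s t).2 <> (lbl s' t).2;
  adh1 : bool -> set G1;
  adh2 : bool -> set G2;
  idmap : bool -> bool -> G1 -> G2;
  idmap_bij : forall k l, set_bij (adh1 k) (adh2 l) (idmap k l) }.

Section Amalgam.
Context {G1 G2 : graph} (D : amalgam_data G1 G2).

(* the vertices of the disjoint union of all copies *)
Definition copies : Type := (V1 * G1) + (V2 * G2).

Definition copies_adj (u v : copies) : Prop :=
  match u, v with
  | inl (s, x), inl (s', x') => s = s' /\ adj x x'
  | inr (t, y), inr (t', y') => t = t' /\ adj y y'
  | _, _ => False
  end.

Inductive glue : copies -> copies -> Prop :=
  Glue (s : V1) (t : V2) (x : G1) :
    adj (sval s) (sval t) -> adh1 D (lbl D s t).1 x ->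
    glue (inl (s, x))
         (inr (t, idmap D (lbl D s t).1 (lbl D s t).2 x)).

Definition glue_class (u : copies) : set copies :=
  [set v | clos_refl_sym_trans copies glue u v].

Definition amalgam_vert : Type := {A : set copies | exists u, A = glue_class u}.

Definition amalgam_proj (u : copies) : amalgam_vert :=
  exist _ (glue_class u) (ex_intro _ u erefl).

(* Parallel edges are merged.  As distinct vertices of one copy are never
   identified, no edge becomes a loop and [A <> B] discards nothing. *)
Definition amalgam_adj : rel amalgam_vert := fun A B =>
  `[< A <> B /\ exists u v, [/\ sval A u, sval B v & copies_adj u v] >].

Lemma amalgam_adj_sym : symmetric amalgam_adj.
Proof.
have sym u v : copies_adj u v -> copies_adj v u.
  by case: u v => [[s x]|[s x]] [[s' x']|[s' x']] //= [-> h]; rewrite adj_sym.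
have H A B : amalgam_adj A B -> amalgam_adj B A.
  move=> /asboolP[nAB [u [v [Au Bv uv]]]]; apply/asboolP; split.
    by move=> BA; apply: nAB.
  by exists v, u; split => //; exact: sym.
by move=> A B; apply/idP/idP; exact: H.
Qed.

Lemma amalgam_adj_irr : irreflexive amalgam_adj.
Proof. by move=> A; apply/asboolP => -[]. Qed.

Definition amalgam : graph := Graph amalgam_adj_sym amalgam_adj_irr.

Definition copy1 (s : V1) (x : G1) : amalgam := amalgam_proj (inl (s, x)).
Definition copy2 (t : V2) (y : G2) : amalgam := amalgam_proj (inr (t, y)).

Definition thin :=
  (forall k, finite_set (adh1 D k)) /\ (forall l, finite_set (adh2 D l)).

Definition strongly_thin := [/\ thin, rayless G1 & rayless G2].

(* Here [f] is an isomorphism to [G], through which the copies are regarded as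
   subgraphs of [G]: the two adhesions glued along an edge [st] are one and the
   same subset of [G], and the identifying map, read between the two copies
   inside [G], is the identity of that subset. *)
Definition identifying_maps_identity (G : graph) (f : amalgam -> G) :=
  forall (s : V1) (t : V2), adj (sval s) (sval t) ->
    let k := (lbl D s t).1 in let l := (lbl D s t).2 in
    (f \o copy1 s) @` adh1 D k = (f \o copy2 t) @` adh2 D l /\
    forall x, adh1 D k x -> f (copy2 t (idmap D k l x)) = f (copy1 s x).

End Amalgam.

Section SelfAmalgam.
Context {G : graph} (D : amalgam_data G G).

Definition is_adhesion (A : set G) := range (adh1 D) A \/ range (adh2 D) A.

(* A copy of [G] contains two adhesions, [adh1 D 0], [adh1 D 1] or [adh2 D 0],
   [adh2 D 1], and these are disjoint.  Adhesions from different families may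
   coincide as subsets of [G] and are otherwise disjoint; asking for
   [adh1 D k] and [adh2 D l] to be always disjoint would exclude already the
   natural splitting of the double ray into edges. *)
Definition adhesions_pairwise_disjoint :=
  [/\ adh1 D false `&` adh1 D true = set0,
      adh2 D false `&` adh2 D true = set0 &
      forall A B, is_adhesion A -> is_adhesion B -> A <> B -> A `&` B = set0].

End SelfAmalgam.

Definition splits_strongly_thin (G : graph) :=
  exists (Gb : graph) (D : amalgam_data Gb Gb) (f : amalgam D -> G),
    [/\ is_iso f,
        strongly_thin D,
        [/\ connected_graph Gb, rayless Gb & finite_diameter Gb],
        identifying_maps_identity f &
        (forall A, is_adhesion D A -> finite_set A /\ connected_set A) /\
        adhesions_pairwise_disjoint D].

(* Main.v *)
Require Import Defs.
From mathcomp Require Import all_boot all_order all_algebra.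
From mathcomp Require Import boolp classical_sets functions cardinality reals.
From mathcomp Require Import zify lra.
From Stdlib Require Import Relation_Operators.

(** The three statements are proved in a cycle.  Write [reach S r] for the
    component of the complement of a finite set [S] that contains a tail of the
    ray [r].  Domination enters through [dominated_of_bounded]: if, outside every
    finite set, some vertex at distance at most [D] from a fixed vertex is joined
    to a tail of [r], then the end of [r] is dominated.  In particular, without
    dominated ends every ray leaves every ball ([ray_leaves_ball]), which replaces
    the compactness available in locally finite graphs.

    From two ends to the splitting ([two_ended_splits]).  Let [p] and [q] be rays
    of the two ends and [S] a finite connected set separating them.  Infinitely
    many vertices of [p] lie in one orbit, and they leave every ball, so some
    automorphisms move [S] arbitrarily far along [p]; a pair of them yields an
    automorphism [g] that fixes both ends and moves a separator [S] beyond itself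
    ([translation_exists]).  Let [B] be the complement of [reach S p].  The
    translates of [B] under the powers of [g] increase from the empty set to the
    whole graph, and the edges leaving a translate start in the corresponding
    translate of [S].  Hence the graph is the union of the translates of one slice,
    which overlap exactly in the translates of [S]: this is the amalgamation
    ([unfold_iso]).  The slice has no ray, since such a ray would belong to a third
    end.  It has finite diameter, since by quasi-transitivity every vertex is
    close to some image of [S], and such an image meets a bounded neighbourhood of
    the translates of [S], because it separates the ends ([near_translates]).

    From the splitting to the quasi-isometry ([splitting_coarse_line]).  Send a
    vertex to the index of a copy containing it.  Since the adhesions in a copy are
    disjoint, a vertex lies in at most two copies, so this map is Lipschitz; since
    consecutive copies intersect and copies have bounded diameter, it does not
    contract too much.

    From the quasi-isometry to two ends ([coarse_line_two_ended]).  Every ray tends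
    to one of the two sides of the line, rays on the same side are equivalent, and
    rays on different sides are not: otherwise infinitely many connections between
    them, disjoint from given finite sets, would pass through a bounded set, and
    the end would be dominated.  That both sides contain rays is where
    quasi-transitivity is used.  Far away every automorphism preserves or reverses
    the order of the line ([iso_orientation]), so the quotient of two suitable
    automorphisms is a translation, and the images of a walk under its powers
    contain rays to both sides ([ray_of_translation]). *)

Set Implicit Arguments.
Unset Strict Implicit.
Unset Printing Implicit Defensive.
Import Order.TTheory GRing.Theory Num.Theory.
Local Open Scope classical_set_scope.

(** * Walks and the graph metric *)

Section Joined.
Context {G : graph}.
Implicit Types (A B S : set G) (x y z : G).

Lemma walk_cat x y z p q : walk x y p -> walk y z q -> walk x z (p ++ q).
Proof.
by move=> [pp lp] [pq lq]; split; rewrite ?cat_path ?last_cat ?lp ?pp.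
Qed.

Lemma walk_rev x y p : walk x y p -> walk y x (rev (belast x p)).
Proof.
case=> pp <-; split.
  by rewrite rev_path; apply: sub_path pp => a b; rewrite adj_sym.
by case: p pp => //= a p _; rewrite rev_cons last_rcons.
Qed.

Lemma joined_refl A x : A x -> joined_in A x x.
Proof. by move=> Ax; exists [::] => //=; rewrite andbT; apply/mem_set. Qed.

Lemma joined_trans A x y z :
  joined_in A x y -> joined_in A y z -> joined_in A x z.
Proof.
move=> [p wp ap] [q wq aq]; exists (p ++ q); first exact: walk_cat wp wq.
by rewrite -[x :: _]/((x :: p) ++ q) all_cat ap; case/andP: aq.
Qed.

Lemma joined_sym A x y : joined_in A x y -> joined_in A y x.
Proof.
move=> [p wp ap]; exists (rev (belast x p)); first exact: walk_rev.
by case: wp ap => _ <-; rewrite lastI -rev_rcons all_rev.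
Qed.

Lemma joined_adj A x y : A x -> A y -> adj x y -> joined_in A x y.
Proof.
move=> Ax Ay xy; exists [:: y]; first by split => //=; rewrite xy.
by rewrite /= !mem_set.
Qed.

Lemma joined_mono A B x y : A `<=` B -> joined_in A x y -> joined_in B x y.
Proof.
move=> AB [p wp ap]; exists p => //; apply: sub_all ap => z.
by move=> /set_mem /AB /mem_set.
Qed.

Lemma joined_ind A (P : G -> Prop) x y : joined_in A x y -> P x ->
  (forall u v, A u -> A v -> adj u v -> joined_in A x u -> P u -> P v) -> P y.
Proof.
move=> [p]; elim/last_ind: p y => [|p z IH] y.
  by move=> [_ <-].
move=> [pp ly] ap Px step; rewrite last_rcons in ly; subst z.
move: pp ap; rewrite rcons_path -rcons_cons all_rcons => /andP[pp aly].
move=> /andP[/set_mem Ay ap].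
have j : joined_in A x (last x p) by exists p.
apply: (step (last x p)) => //.
  by apply: set_mem; case/lastP: (p) ap => [|p' u];
     rewrite ?last_rcons -?rcons_cons ?all_rcons => /andP[].
by apply: (IH (last x p)) => //; split.
Qed.

Lemma joined_l A x y : joined_in A x y -> A x.
Proof. by move=> [p _ /= /andP[/set_mem]]. Qed.

Lemma joined_r A x y : joined_in A x y -> A y.
Proof. by move=> /joined_sym /joined_l. Qed.

Lemma joined_self A x y : joined_in A x y -> joined_in (joined_in A x) x y.
Proof.
move=> j; apply: (joined_ind j); first exact/joined_refl/joined_refl/(joined_l j).
move=> u v Au Av uv ju jju; apply: joined_trans jju _.
apply: joined_adj => //; apply: joined_trans ju _; exact: joined_adj.
Qed.

End Joined.

Section Connected.
Context {G : graph} (cG : connected_graph G).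
Implicit Types (A B S : set G) (x y z : G).

Lemma connectedE x y : joined_in [set: G] x y.
Proof. by case: cG => _; apply. Qed.

Lemma first_hit U x y : ~ U x -> U y ->
  exists z z', [/\ joined_in (~` U) x z, adj z z' & U z'].
Proof.
move=> Ux Uy.
pose hit := exists z z', [/\ joined_in (~` U) x z, adj z z' & U z'].
suff [/joined_r//|//] : joined_in (~` U) x y \/ hit.
apply: (joined_ind (P := fun y => joined_in (~` U) x y \/ hit)
                   (connectedE x y)); first by left; exact: joined_refl.
move=> u v _ _ uv _ [ju|]; last by right.
have [Uv|Uv] := pselect (U v); first by right; exists u, v.
left; apply: (joined_trans ju); apply: joined_adj => //; exact: joined_r ju.
Qed.

Lemma gdistP x y : (exists2 p, walk x y p & size p = gdist x y) /\
  (forall p, walk x y p -> (gdist x y <= size p)%N).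
Proof.
rewrite /gdist; case: xgetP => [n -> [h1 h2]|h]; first by split.
exfalso.
have [p wp _] := connectedE x y.
have : exists n, `[< exists2 p, walk x y p & size p = n >].
  by exists (size p); apply/asboolP; exists p.
move=> /ex_minnP[n /asboolP e m]; apply: (h n); split=> // q wq.
by apply: m; apply/asboolP; exists q.
Qed.

Lemma gdist_le x y p : walk x y p -> (gdist x y <= size p)%N.
Proof. by case: (gdistP x y) => _; apply. Qed.

Lemma gdist_walk x y : exists2 p, walk x y p & size p = gdist x y.
Proof. by case: (gdistP x y). Qed.

Lemma gdistxx x : gdist x x = 0%N.
Proof. by apply/eqP; rewrite -leqn0; exact: (@gdist_le x x [::]). Qed.

Lemma gdist0 x y : gdist x y = 0%N -> x = y.
Proof. by have [[|z p] [_ ly] <-] := gdist_walk x y. Qed.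

Lemma gdist_adj x y : adj x y -> (gdist x y <= 1)%N.
Proof. by move=> xy; apply: (@gdist_le x y [:: y]); split => //=; rewrite xy. Qed.

Lemma gdist_tri y x z : (gdist x z <= gdist x y + gdist y z)%N.
Proof.
have [p wp <-] := gdist_walk x y; have [q wq <-] := gdist_walk y z.
by rewrite -size_cat; apply/gdist_le/walk_cat; eassumption.
Qed.

Lemma gdist_sym x y : gdist x y = gdist y x.
Proof.
have h (a b : G) : (gdist a b <= gdist b a)%N.
  have [p wp <-] := gdist_walk b a.
  by have := gdist_le (walk_rev wp); rewrite size_rev size_belast.
by apply/eqP; rewrite eqn_leq !h.
Qed.

Lemma gdist_step x y n : gdist x y = n.+1 ->
  exists2 z, adj x z & gdist z y = n.
Proof.
move=> e; have [p] := gdist_walk x y; rewrite e.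
case: p => [|z p] // [/= /andP[xz pz] l] [s].
exists z => //; apply/eqP; rewrite eqn_leq; apply/andP; split.
  have : walk z y p by split.
  by move/gdist_le; rewrite s.
have := gdist_tri z x y; have := gdist_adj xz; lia.
Qed.

(** A geodesic stays in the metric interval of its ends.  This is how short
    connections are shown to avoid sets that are far away. *)
Lemma geodesic_joined A x y :
  (forall z, (gdist x z + gdist z y <= gdist x y)%N -> A z) ->
  joined_in A x y.
Proof.
move: {2}(gdist x y) (erefl (gdist x y)) => n.
elim: n x => [|n IH] x e h.
  by move/gdist0: (e) => exy; subst y; apply: joined_refl; apply: h; rewrite gdistxx.
have [z xz zy] := gdist_step e; have xz1 := gdist_adj xz.
have Ax : A x by apply: h; rewrite gdistxx.
have Az : A z by apply: h; lia.
apply: joined_trans (joined_adj Ax Az xz) _.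
by apply: IH => // u uh; apply: h; have := gdist_tri z x u; lia.
Qed.

Lemma gdist_lipschitz (phi : G -> int) (k : nat) :
  (forall x y, adj x y -> (`|phi x - phi y|%N <= k)%N) ->
  forall x y, (`|phi x - phi y|%N <= k * gdist x y)%N.
Proof.
move=> h x y; move: {2}(gdist x y) (erefl (gdist x y)) => n.
elim: n x => [|n IH] x e.
  by rewrite (gdist0 e); lia.
have [z xz zy] := gdist_step e; have := IH _ zy; have := h _ _ xz.
by rewrite e zy mulnS; lia.
Qed.

Lemma finite_set_bounded_gdist S x :
  finite_set S -> exists D, forall s, S s -> (gdist x s <= D)%N.
Proof.
move=> fS; have : finite_set (gdist x @` S) by exact: finite_image.
move=> /finite_seqP[s es]; exists (\max_(n <- s) n) => y Sy.
apply: (@leq_bigmax_seq _ _ xpredT id) => //.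
have : (gdist x @` S) (gdist x y) by exists y.
by rewrite es.
Qed.

(** Joining the points of a finite set to a base point by walks makes it
    connected, at the cost of finitely many vertices. *)
Lemma finite_connected_hull S : finite_set S ->
  exists S', [/\ finite_set S', connected_set S' & S `<=` S'].
Proof.
move=> fS; have [[o _] _] := cG.
have /choice[P HP] (s : G) : exists P, [/\ finite_set P, P s &
    forall x, P x -> joined_in P o x].
  have [p [pp lp]] := connectedE o s; move=> _.
  elim/last_ind: p s pp lp => [|p z IH] s.
    move=> _ /= <-; exists [set o]; split => // x ->; exact: joined_refl.
  rewrite rcons_path last_rcons => /andP[pp az] e; subst z.
  have [P [fP Pl jP]] := IH _ pp erefl.
  exists (P `|` [set s]); split; [by rewrite finite_setU|by right|].
  have sub : P `<=` P `|` [set s] by left.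
  move=> x [Px|->]; first exact: joined_mono (jP x Px).
  apply: joined_trans (joined_mono sub (jP _ Pl)) _.
  by apply: joined_adj => //; [left|right].
exists (\bigcup_(s in S `|` [set o]) P s); split.
- by apply: bigcup_finite => [|i _]; [rewrite finite_setU|case: (HP i)].
- split; first by exists o, o; [right|case: (HP o)].
  have j x : (\bigcup_(s in S `|` [set o]) P s) x ->
      joined_in (\bigcup_(s in S `|` [set o]) P s) o x.
    move=> [s Ss Px]; have [_ _ /(_ _ Px)] := HP s.
    by apply: joined_mono => y Py; exists s.
  by move=> x y /j/joined_sym jx /j; exact: joined_trans.
- by move=> s Ss; exists s; [left|case: (HP s)].
Qed.

End Connected.

(** * Rays, ends and domination *)

Section Rays.
Context {G : graph}.
Implicit Types (A B S : set G) (x y z : G) (r : nat -> G).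

Lemma component_eq S x y :
  joined_in (~` S) x y -> component_of S x = component_of S y.
Proof.
move=> j; apply/seteqP; split=> z jz; last exact: joined_trans j jz.
exact: joined_trans (joined_sym j) jz.
Qed.

Lemma ray_leaves S r : is_ray r -> finite_set S ->
  exists N, forall n, (N <= n)%N -> ~ S (r n).
Proof.
move=> [inj _] fS.
have : finite_set (r @^-1` S) by apply: finite_preimage => // a b _ _ /inj.
move=> /finite_seqP[s es]; exists (\max_(n <- s) n).+1 => n lt_n Sn.
have ns : n \in s by have : (r @^-1` S) n by []; rewrite es.
have : (n <= \max_(n <- s) n)%N by exact: (@leq_bigmax_seq _ _ xpredT id).
by rewrite leqNgt lt_n.
Qed.

Lemma ray_tail S r : is_ray r -> finite_set S ->
  exists N, forall m n, (N <= m)%N -> (N <= n)%N ->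
    joined_in (~` S) (r m) (r n).
Proof.
move=> ray fS; have [N HN] := ray_leaves ray fS; exists N => m n Nm Nn.
suff h k : joined_in (~` S) (r N) (r (N + k)%N).
  by have := joined_trans (joined_sym (h (m - N)%N)) (h (n - N)%N); rewrite !subnKC.
elim: k => [|k IH]; first by rewrite addn0; apply: joined_refl; exact: HN.
apply: (joined_trans IH); rewrite addnS; apply: joined_adj.
- by apply: HN; lia.
- by apply: HN; lia.
- by case: ray.
Qed.

(** For finite [S] and a ray [r], the set [reach S r] is the component of the
    complement of [S] in which [r] has a tail. *)
Definition reach S r : set G :=
  [set x | exists N, forall n, (N <= n)%N -> joined_in (~` S) x (r n)].

Definition eventually_joined S r r' :=
  exists N, forall m n, (N <= m)%N -> (N <= n)%N -> joined_in (~` S) (r m) (r' n).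

Lemma reach_tail S r : is_ray r -> finite_set S ->
  exists N, forall n, (N <= n)%N -> reach S r (r n).
Proof.
move=> ray fS; have [N HN] := ray_tail ray fS.
by exists N => n Nn; exists N => m Nm; exact: HN.
Qed.

Lemma reach_joined S r x y : joined_in (~` S) x y -> reach S r y -> reach S r x.
Proof. by move=> j [N HN]; exists N => n /HN; exact: joined_trans j. Qed.

Lemma reach_anti S T r x :
  S `<=` T -> reach T r x -> reach S r x.
Proof.
move=> ST [N HN]; exists N => n /HN; apply: joined_mono => z nT Sz; exact/nT/ST.
Qed.

Lemma reach_notin S r x : reach S r x -> ~ S x.
Proof. by move=> [N /(_ _ (leqnn _))/joined_l]. Qed.

(** Tails of a ray are joined among themselves, so a single connection between
    two tails connects all of them. *)
Lemma eventually_joinedP S r r' : is_ray r -> is_ray r' -> finite_set S ->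
  (exists x, reach S r x /\ reach S r' x) <-> eventually_joined S r r'.
Proof.
move=> ray ray' fS; split=> [[x [[N HN] [M HM]]]|[N HN]].
  exists (maxn N M) => m n Nm Nn; apply: joined_trans (joined_sym (HN _ _)) _.
    by lia.
  by apply: HM; lia.
have [M HM] := ray_tail ray fS.
exists (r (maxn N M)); split; exists (maxn N M) => n Nn.
  by apply: HM; lia.
by apply: HN; lia.
Qed.

Lemma ray_equivP r r' : is_ray r -> is_ray r' ->
  ray_equiv r r' <-> forall S, finite_set S -> eventually_joined S r r'.
Proof.
move=> ray ray'; split=> [e S fS|h [S fS [C [C' [[x _ ->] [x' _ ->] nC [N HN] [M HM]]]]]].
  have [N HN] := ray_tail ray fS; have [M HM] := ray_tail ray' fS.
  apply: contrapT => nj; apply: e; exists S => //.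
  exists (component_of S (r N)), (component_of S (r' M)); split.
  - exists (r N) => //; exact: joined_l (HN _ _ (leqnn _) (leqnn _)).
  - exists (r' M) => //; exact: joined_l (HM _ _ (leqnn _) (leqnn _)).
  - move=> e; apply/nj/eventually_joinedP => //; exists (r N); split.
      by exists N => n; exact: HN.
    exists M => n Mn; have : component_of S (r' M) (r' n) by exact: HM.
    by rewrite -e.
  - by exists N => n; exact: HN.
  - by exists M => n; exact: HM.
apply: nC; have [K HK] := h S fS; pose n := maxn K (maxn N M).
rewrite (component_eq (HN n _)); last by lia.
rewrite (component_eq (HM n _)); last by lia.
by apply: component_eq; apply: HK; lia.
Qed.

Lemma ray_equiv_refl r : is_ray r -> ray_equiv r r.
Proof.
by move=> ray; apply/ray_equivP => // S fS; have [N] := ray_tail ray fS; exists N.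
Qed.

Lemma ray_equiv_sym r r' : is_ray r -> is_ray r' ->
  ray_equiv r r' -> ray_equiv r' r.
Proof.
move=> ray ray' /(ray_equivP ray ray') h; apply/ray_equivP => // S /h[N HN].
by exists N => m n Nm Nn; apply/joined_sym/HN.
Qed.

Lemma ray_equiv_trans r1 r2 r3 : is_ray r1 -> is_ray r2 -> is_ray r3 ->
  ray_equiv r1 r2 -> ray_equiv r2 r3 -> ray_equiv r1 r3.
Proof.
move=> y1 y2 y3 /(ray_equivP y1 y2) h /(ray_equivP y2 y3) h'.
apply/ray_equivP => // S fS; have [N HN] := h S fS; have [M HM] := h' S fS.
exists (maxn N M) => m n Nm Nn.
by apply: (joined_trans (HN m (maxn N M) _ _)); [lia|lia|apply: HM; lia].
Qed.

Lemma reach_equiv S r r' x : is_ray r -> is_ray r' -> finite_set S ->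
  ray_equiv r r' -> reach S r x -> reach S r' x.
Proof.
move=> y y' fS /(ray_equivP y y') /(_ S fS) [N HN] [M HM].
exists N => n Nn; apply: joined_trans (HM (maxn N M) _) _; first by lia.
by apply: HN; lia.
Qed.

Definition end_of r := [set r' | is_ray r' /\ ray_equiv r r'].

Lemma end_of_eq r r' : is_ray r -> is_ray r' ->
  end_of r = end_of r' <-> ray_equiv r r'.
Proof.
move=> y y'; split=> [e|e].
  have : end_of r' r' by split => //; exact: ray_equiv_refl.
  by rewrite -e => -[].
apply/seteqP; split=> s [ys es]; split=> //.
  exact: ray_equiv_trans (ray_equiv_sym y y' e) es.
exact: ray_equiv_trans e es.
Qed.

Lemma two_endedP : two_ended G <->
  exists r1 r2, [/\ is_ray r1, is_ray r2, ~ ray_equiv r1 r2 &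
    forall r, is_ray r -> ray_equiv r1 r \/ ray_equiv r2 r].
Proof.
rewrite /two_ended; split.
- move=> /card_esym/card_set_bijP[f [ff injf surf]].
  have I0 : `I_2 0%N by []. have I1 : `I_2 1%N by [].
  have [r1 y1 e1] := ff _ I0; have [r2 y2 e2] := ff _ I1.
  exists r1, r2; split => //.
    move=> /(end_of_eq y1 y2) e.
    by have /(injf _ _ (mem_set I0) (mem_set I1)) : f 0%N = f 1%N by rewrite e1 e2.
  move=> r y; have [|n /= n2 en] := surf (end_of r); first by exists r.
  case: n n2 en => [|[|n]] // _ en; [left|right]; apply/end_of_eq => //.
    by rewrite -en e1.
  by rewrite -en e2.
- move=> [r1 [r2 [y1 y2 ne all]]].
  suff -> : ends G = [set end_of r1; end_of r2].
    apply/card_esym/card_set_bijP.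
    exists (fun n : nat => if n == 0%N then end_of r1 else end_of r2); split.
    - by move=> [|[|n]] //= _; [left|right].
    - move=> n m; rewrite !inE /= => n2 m2.
      case: n m n2 m2 => [|[|n]] [|[|m]] //= _ _ e; exfalso; apply: ne.
        exact/end_of_eq.
      exact/end_of_eq/esym.
    - by move=> w [->|->]; [exists 0%N|exists 1%N].
  apply/seteqP; split=> w.
    move=> [r y ->]; have [/end_of_eq e|/end_of_eq e] := all r y.
      by left; apply/esym/e.
    by right; apply/esym/e.
  by case=> ->; [exists r1|exists r2].
Qed.

(** If vertices close to [o] are joined to tails of [r] outside every finite
    set, then the end of [r] is dominated: choosing the distance minimal makes
    the short connections from [o] themselves avoidable. *)
Lemma dominated_of_bounded (cG : connected_graph G) r o D : is_ray r ->
  (forall F, finite_set F ->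
     exists2 m, (gdist o m <= D)%N & reach F r m) ->
  exists v, dominates v (end_of r).
Proof.
move=> ray; elim: D o => [|D IH] o h.
  have [|m] := h [set o]; first exact: finite_set1.
  by rewrite leqn0 => /eqP/(gdist0 cG) <- /reach_notin; case.
have [[f h']|nf] := pselect (exists f, forall F, finite_set F ->
     exists2 m, (gdist f m <= D)%N & reach F r m); first exact: IH h'.
have /choice[K HK] f : exists K, finite_set K /\
    forall m, (gdist f m <= D)%N -> ~ reach K r m.
  apply: contrapT => nK; apply: nf; exists f => F fF.
  apply: contrapT => nm; apply: nK; exists F; split => // m fm rm.
  by apply: nm; exists m.
exists o => -[S [fS So]]; apply.
pose F := S `|` \bigcup_(f in S) K f.
have fF : finite_set F.
  by rewrite finite_setU; split => //; apply: bigcup_finite => // f _; case: (HK f).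
have [m om rm] := h F fF.
have ro : reach S r o.
  apply: (@reach_joined _ _ _ m); last by apply: reach_anti rm => z; left.
  apply: (geodesic_joined cG) => z oz Sz.
  have oz0 : gdist o z <> 0%N by move/(gdist0 cG) => ez; apply: So; rewrite ez.
  have [_ /(_ m)] := HK z; apply; first by lia.
  by apply: reach_anti rm => y Ky; right; exists z.
exists (component_of S o); split; first by exists o.
  move=> r' [ray' e].
  have [N HN] := reach_tail ray' fS.
  have [M HM] := reach_equiv ray ray' fS e ro.
  by exists M => n; exact: HM.
exact: joined_refl.
Qed.

(** A ray whose end is undominated leaves every ball. *)
Lemma ray_leaves_ball (cG : connected_graph G) r o D :
  no_dominated_end G -> is_ray r ->
  exists N, forall n, (N <= n)%N -> (D < gdist o (r n))%N.
Proof.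
move=> nd ray; apply: contrapT => nN; apply: (nd (end_of r)); first by exists r.
apply: (dominated_of_bounded cG ray (o := o) (D := D)) => F fF.
have [N HN] := reach_tail ray fF.
apply: contrapT => nm; apply: nN; exists N => n Nn; rewrite ltnNge.
by apply/negP => le; apply: nm; exists (r n) => //; exact: HN.
Qed.

End Rays.

(** * Automorphisms *)

Section Isomorphisms.
Context {G H : graph}.

Lemma iso_inv (f : G -> H) : is_iso f ->
  exists g : H -> G, [/\ is_iso g, cancel f g & cancel g f].
Proof.
move=> [[g fK gK] fadj]; exists g; split => //; split; first by exists f.
by move=> x y; rewrite -fadj !gK.
Qed.

Lemma iso_inj (f : G -> H) : is_iso f -> injective f.
Proof. by case=> /bij_inj. Qed.

Lemma iso_joined (f : G -> H) A x y : is_iso f ->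
  joined_in A x y -> joined_in (f @` A) (f x) (f y).
Proof.
move=> [_ fadj] j; apply: (joined_ind (P := fun y => joined_in (f @` A) (f x) (f y)) j).
  by apply: joined_refl; exists x => //; exact: joined_l j.
move=> u v Au Av uv _ ju; apply: (joined_trans ju); apply: joined_adj.
- by exists u.
- by exists v.
- by rewrite fadj.
Qed.

Lemma iso_joined_compl (f : G -> H) S x y : is_iso f ->
  joined_in (~` S) x y -> joined_in (~` (f @` S)) (f x) (f y).
Proof.
move=> fi /(iso_joined fi); apply: joined_mono => _ [z Sz <-] [z' Sz'].
by move/(iso_inj fi) => e; subst z'.
Qed.

Lemma iso_ray (f : G -> H) r : is_iso f -> is_ray r -> is_ray (f \o r).
Proof.
move=> fi [ri ra]; split; first by move=> m n /= /(iso_inj fi)/ri.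
by move=> n /=; case: fi => _ ->.
Qed.

Lemma iso_reach (f : G -> H) S r x : is_iso f ->
  reach S r x -> reach (f @` S) (f \o r) (f x).
Proof.
by move=> fi [N HN]; exists N => n /HN j; exact: iso_joined_compl.
Qed.

Lemma iso_eventually_joined (f : G -> H) S r r' : is_iso f ->
  eventually_joined S r r' -> eventually_joined (f @` S) (f \o r) (f \o r').
Proof.
by move=> fi [N HN]; exists N => m n Nm Nn; apply: iso_joined_compl => //; exact: HN.
Qed.

Lemma gdist_hom (f : G -> H) : connected_graph G -> connected_graph H ->
  (forall x y, adj x y -> f x = f y \/ adj (f x) (f y)) ->
  forall x y, (gdist (f x) (f y) <= gdist x y)%N.
Proof.
move=> cG cH h x y; move: {2}(gdist x y) (erefl (gdist x y)) => n.
elim: n x => [|n IH] x e; first by rewrite (gdist0 cG e) (gdistxx cH).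
have [z xz zy] := gdist_step cG e; have := IH _ zy; rewrite e zy => le.
have := gdist_tri cH (f z) (f x) (f y).
have [->|/(gdist_adj cH)] := h _ _ xz; first by lia.
by lia.
Qed.

Lemma gdist_iso (f : G -> H) : connected_graph G -> connected_graph H ->
  is_iso f -> forall x y, gdist (f x) (f y) = gdist x y.
Proof.
move=> cG cH fi x y; apply/eqP; rewrite eqn_leq gdist_hom //=; last first.
  by move=> u v uv; right; rewrite fi.2.
have [g [[_ gadj] fK gK]] := iso_inv fi.
rewrite -{1}[x]fK -{1}[y]fK.
move: (f x) (f y); clear x y => x y.
move: {2}(gdist x y) (erefl (gdist x y)) => n.
elim: n x => [|n IH] x e; first by rewrite (gdist0 cH e) (gdistxx cG).
have [z xz zy] := gdist_step cH e; have := IH _ zy; rewrite e zy => le.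
have := gdist_tri cG (g z) (g x) (g y).
by have := gdist_adj cG (_ : adj (g x) (g z)); rewrite gadj => /(_ xz); lia.
Qed.

Lemma iso_connected_set (f : G -> H) S : is_iso f ->
  connected_set S -> connected_set (f @` S).
Proof.
move=> fi [[s Ss] jS]; split; first by exists (f s), s.
by move=> _ _ [x Sx <-] [y Sy <-]; apply: iso_joined => //; exact: jS.
Qed.

End Isomorphisms.

Lemma iso_reachE (G : graph) (h : G -> G) S r x : is_iso h ->
  reach (h @` S) (h \o r) (h x) <-> reach S r x.
Proof.
move=> hi; split; last exact: iso_reach.
have [k [ki hk kh]] := iso_inv hi.
move/(iso_reach ki); rewrite hk.
have -> : k @` (h @` S) = S.
  rewrite image_comp; apply/seteqP; split=> [_ [y Sy <-]|y Sy]; first by rewrite /= hk.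
  by exists y => //=; rewrite hk.
by move=> [N HN]; exists N => n /HN /=; rewrite hk.
Qed.

Lemma iso_ray_equiv (G : graph) (h : G -> G) r r' : is_iso h ->
  is_ray r -> is_ray r' -> ray_equiv r r' -> ray_equiv (h \o r) (h \o r').
Proof.
move=> hi y y' /(ray_equivP y y') e.
apply/(ray_equivP (iso_ray hi y) (iso_ray hi y')) => S fS.
have [k [ki hk kh]] := iso_inv hi.
have -> : S = h @` (k @` S).
  rewrite image_comp; apply/seteqP; split=> [x Sx|_ [x Sx <-]]; last by rewrite /= kh.
  by exists x => //=; rewrite kh.
by apply: iso_eventually_joined => //; apply: e; exact: finite_image.
Qed.

Lemma iso_ray_equivE (G : graph) (h : G -> G) r r' : is_iso h ->
  is_ray r -> is_ray r' -> ray_equiv (h \o r) (h \o r') -> ray_equiv r r'.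
Proof.
move=> hi y y'; have [k [ki hk kh]] := iso_inv hi.
move/(iso_ray_equiv ki (iso_ray hi y) (iso_ray hi y')).
by congr ray_equiv; apply/funext => n /=; rewrite hk.
Qed.

Lemma orbit_representatives (G : graph) : quasi_transitive G ->
  exists2 X : set G, finite_set X &
    forall x, exists x0 (h : G -> G), [/\ X x0, is_iso h & h x0 = x].
Proof.
move=> qt; have [[o]|no] := pselect (inhabited G); last first.
  by exists set0 => // x; case: no.
have /choice[rep Hrep] (O : set G) : exists x,
    range (@aut_orbit G) O -> aut_orbit x = O.
  have [[x _ e]|nO] := pselect (range (@aut_orbit G) O); first by exists x.
  by exists o.
exists (rep @` range (@aut_orbit G)); first exact: finite_image.
move=> x; have xr : range (@aut_orbit G) (aut_orbit x) by exists x.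
have : aut_orbit x x by exists id => //; split => //; exists id.
rewrite -{1}(Hrep _ xr) => -[h hi e].
by exists (rep (aut_orbit x)), h; split => //; exists (aut_orbit x).
Qed.

Section Pigeonhole.
Context {G : graph}.

Lemma iso_comp (f g : G -> G) : is_iso f -> is_iso g -> is_iso (f \o g).
Proof.
move=> [bf fa] [bg ga]; split; first exact: bij_comp.
by move=> x y /=; rewrite fa ga.
Qed.

Lemma iso_iter (f : G -> G) n : is_iso f -> is_iso (iter n f).
Proof.
move=> fi; elim: n => [|n IH]; first by split => //; exists id.
exact: (iso_comp fi IH).
Qed.

(** The pigeonhole principle for orbits: finitely many orbits share the infinitely
    many members of the sequence. *)
Lemma orbit_recurrence (u : nat -> G) : quasi_transitive G ->
  exists i, forall N, exists n (h : G -> G), [/\ (N <= n)%N, is_iso h & h (u i) = u n].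
Proof.
move=> qt; apply: contrapT => nh.
have : finite_set [set: nat].
  apply: (@sub_finite_set _ _ (\bigcup_(O in range (@aut_orbit G))
            [set n | aut_orbit (u n) = O])).
    by move=> n _; exists (aut_orbit (u n)) => //; exists (u n).
  apply: bigcup_finite => // O _.
  have [[i /= iO]|ni] := pselect ([set n | aut_orbit (u n) = O] !=set0); last first.
    by apply: (sub_finite_set _ (finite_set0 nat)) => n nO; apply: ni; exists n.
  have [N HN] : exists N, forall n, aut_orbit (u n) = O -> (n < N)%N.
    apply: contrapT => nN; apply: nh; exists i => N; apply: contrapT => nn.
    apply: nN; exists N => n nO; rewrite ltnNge; apply/negP => Nn; apply: nn.
    have : aut_orbit (u n) (u n) by exists id => //; split => //; exists id.
    by rewrite nO -iO => -[h hi e]; exists n, h.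
  exact: (sub_finite_set HN (finite_II N)).
exact: infinite_nat.
Qed.

(** A walk that visits every vertex only finitely often becomes a ray when it is
    continued from the last visit of each of its vertices. *)
Lemma ray_of_walk (w : nat -> G) : (forall n, adj (w n) (w n.+1)) ->
  (forall x, exists N, forall n, (N <= n)%N -> w n <> x) ->
  exists r (idx : nat -> nat),
    is_ray r /\ forall k, (k <= idx k)%N /\ r k = w (idx k).
Proof.
move=> wa wf.
have /choice[L HL] n : exists m, [/\ (n <= m)%N, w m = w n &
    forall k, (m < k)%N -> w k <> w n].
  have [N HN] := wf (w n).
  have ex : exists m, `[< w m = w n >] by exists n; apply/asboolP.
  have ub m : `[< w m = w n >] -> (m <= N)%N.
    by move=> /asboolP e; rewrite leqNgt; apply/negP => /ltnW /HN.
  have [m /asboolP e mm] := ex_maxnP ex ub; exists m; split => //.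
    by apply: mm; apply/asboolP.
  by move=> k mk /asboolP/mm; rewrite leqNgt mk.
pose idx := fix idx k := if k is k'.+1 then L (idx k').+1 else L 0%N.
have idxS k : (idx k < idx k.+1)%N by rewrite /=; case: (HL (idx k).+1).
have lidx j k : (j < k)%N -> (idx j < idx k)%N.
  elim: k => // k IH; rewrite ltnS leq_eqVlt => /orP[/eqP->//|/IH h].
  exact: ltn_trans h _.
have last_visit j n : (idx j < n)%N -> w n <> w (idx j).
  by case: j => [|j] /=; [have [_ e h] := HL 0%N|have [_ e h] := HL (idx j).+1];
     rewrite e; exact: h.
exists (w \o idx), idx; split; last first.
  by move=> k; split => //; elim: k => // k IH; exact: leq_ltn_trans IH _.
split; last by move=> n /=; have [_ -> _] := HL (idx n).+1.
move=> j k /= e; apply/eqP; rewrite eqn_leq; apply/andP; split;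
  rewrite leqNgt; apply/negP => /lidx; move/last_visit; apply => //.
Qed.

End Pigeonhole.

(** * Automorphisms and ends of graphs that look like a line *)

(** A quasi-isometry to the double ray.  Rounding its real constants up to one
    natural number keeps all estimates in integer arithmetic. *)
Definition coarse_line {G : graph} (phi : G -> int) (A : nat) :=
  [/\ forall x y, (`|phi x - phi y|%N <= A * gdist x y + A)%N,
      forall x y, (gdist x y <= A * `|phi x - phi y|%N + A)%N &
      forall n : int, exists x, (`|n - phi x|%N <= A)%N].

Definition tends_right {G : graph} (phi : G -> int) (r : nat -> G) :=
  forall M : int, exists N, forall n, (N <= n)%N -> (M <= phi (r n))%R.

Definition far_preserving {G : graph} (phi : G -> int) (K : nat) (h : G -> G) :=
  forall a b, (phi a + K%:Z <= phi b -> phi (h a) < phi (h b))%R.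

Definition far_reversing {G : graph} (phi : G -> int) (K : nat) (h : G -> G) :=
  forall a b, (phi a + K%:Z <= phi b -> phi (h b) < phi (h a))%R.

Section CoarseLine.
Context {G : graph} (cG : connected_graph G) (A : nat).
Implicit Types (phi : G -> int) (h : G -> G).

Lemma coarse_line_opp phi : coarse_line phi A -> coarse_line (fun x => - phi x)%R A.
Proof.
move=> [U L S]; split=> [x y|x y|n].
- by have := U x y; lia.
- by have := L x y; rewrite -abszN opprD opprK; apply.
- by have [x] := S (- n)%R; exists x; lia.
Qed.

Lemma coarse_upper phi x y n : coarse_line phi A -> (gdist x y <= n)%N ->
  (`|phi x - phi y|%N <= A * n + A)%N.
Proof.
move=> [U _ _] le; apply: leq_trans (U x y) _.
by rewrite leq_add2r leq_mul2l le orbT.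
Qed.

Lemma coarse_lower phi x y n : coarse_line phi A ->
  (`|phi x - phi y|%N <= n)%N -> (gdist x y <= A * n + A)%N.
Proof.
move=> [_ L _] le; apply: leq_trans (L x y) _.
by rewrite leq_add2r leq_mul2l le orbT.
Qed.

Lemma coarse_adj phi x y : coarse_line phi A -> adj x y ->
  (`|phi x - phi y|%N <= A + A)%N.
Proof. by move=> q /(gdist_adj cG) /(coarse_upper q); rewrite muln1. Qed.

(** How far [phi (h x)] can move while [phi x] moves by at most [2 * A + 1]. *)
Let C := (A * (A * (A + A + 1) + A) + A)%N.
(** Vertices at least this far apart on the line have images more than [C] apart. *)
Let K0 := (A * (A * C + A) + A).+1.
(** The summand [A] makes up for the inexactness of coarse preimages. *)
Definition far_const := (K0 + A)%N.

Lemma iso_coarse_upper phi h x y n : coarse_line phi A -> is_iso h ->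
  (`|phi x - phi y|%N <= n)%N ->
  (`|phi (h x) - phi (h y)|%N <= A * (A * n + A) + A)%N.
Proof.
move=> q hi le; apply: coarse_upper => //; rewrite (gdist_iso cG cG hi).
exact: (coarse_lower q le).
Qed.

Lemma iso_coarse_lower phi h x y n : coarse_line phi A -> is_iso h ->
  (A * (A * n + A) + A < `|phi x - phi y|%N)%N ->
  (n < `|phi (h x) - phi (h y)|%N)%N.
Proof.
move=> q hi; rewrite !ltnNge; apply: contra => le.
by apply: (coarse_upper q); rewrite -(gdist_iso cG cG hi); exact: (coarse_lower q le).
Qed.

(** The order of the images of [a] and [b] does not depend on the vertex [b], as
    long as [b] lies far to the right of [a]: it can be moved to the right in
    steps too short to change that order. *)
Lemma far_order_right phi h a b b' : coarse_line phi A -> is_iso h ->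
  (phi a + far_const%:Z <= phi b -> phi a + far_const%:Z <= phi b' ->
   phi (h a) < phi (h b) -> phi (h a) < phi (h b'))%R.
Proof.
move=> q hi ab ab'; have [_ _ /choice[psi Hpsi]] := q.
have far c : (phi a + K0%:Z <= phi c)%R -> (C < `|phi (h a) - phi (h c)|%N)%N.
  by move=> ac; apply: (iso_coarse_lower q hi); rewrite /K0 in ac *; lia.
have near c c' : (`|phi c - phi c'|%N <= A + A + 1)%N ->
    (`|phi (h c) - phi (h c')|%N <= C)%N.
  exact: (iso_coarse_upper q hi).
have step c : (phi a + far_const%:Z <= phi c)%R -> forall k : nat,
    (phi (h a) < phi (h c))%R = (phi (h a) < phi (h (psi (phi c + k%:Z))))%R.
  rewrite /far_const => ac; elim=> [|k IH].
    have H0 := Hpsi (phi c + 0%:Z)%R.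
    have := near c (psi (phi c + 0%:Z)%R); have := far c; have := far (psi (phi c + 0%:Z)%R).
    by lia.
  rewrite IH; have H1 := Hpsi (phi c + k%:Z)%R; have H2 := Hpsi (phi c + k.+1%:Z)%R.
  have := near (psi (phi c + k%:Z)%R) (psi (phi c + k.+1%:Z)%R).
  have := far (psi (phi c + k%:Z)%R); have := far (psi (phi c + k.+1%:Z)%R).
  by lia.
pose M := Num.max (phi b) (phi b').
have e c : (phi c <= M)%R -> (phi c + `|M - phi c|%N%:Z = M)%R by lia.
rewrite (step b ab `|M - phi b|%N) (step b' ab' `|M - phi b'|%N).
by rewrite !e // /M; lia.
Qed.

(** Both members of a far pair can be replaced independently without changing
    the order of their images, so any two far pairs can be compared through a
    vertex far to the right of both. *)
Lemma iso_orientation phi h : coarse_line phi A -> is_iso h ->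
  far_preserving phi far_const h \/ far_reversing phi far_const h.
Proof.
move=> q hi; have [_ _ S] := q.
have [[a0 [b0 [far0 lt0]]]|none] := pselect (exists a b,
    (phi a + far_const%:Z <= phi b)%R /\ (phi (h a) < phi (h b))%R).
- left=> a b ab.
  have [c Hc] := S (Num.max (phi a) (phi a0) + (far_const + A)%:Z)%R.
  have lt1 : (phi (h a0) < phi (h c))%R.
    by apply: (far_order_right q hi _ _ lt0) => //; lia.
  have lt2 : (phi (h a) < phi (h c))%R.
    have := @far_order_right _ h c a0 a (coarse_line_opp q) hi.
    by rewrite !ltrN2; apply => //; lia.
  by apply: (far_order_right q hi _ _ lt2) => //; lia.
- right=> a b ab; rewrite ltNge; apply/negP => le.
  have nlt : (phi (h a) < phi (h b))%R <> true.
    by move=> lt; apply: none; exists a, b.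
  have : (0 < `|phi (h a) - phi (h b)|)%N.
    by apply: (iso_coarse_lower q hi); rewrite /far_const /K0 /C in ab *; lia.
  by lia.
Qed.

Definition far_const2 := (A * (A * far_const + A) + A).+1.

Lemma iso_far phi h a b : coarse_line phi A -> is_iso h ->
  (far_const2 <= `|phi a - phi b|)%N ->
  (far_const < `|phi (h a) - phi (h b)|)%N.
Proof. by move=> q hi le; apply: (iso_coarse_lower q hi). Qed.

(** Source of order preserving automorphisms: of any three automorphisms two have
    the same orientation.  One pair of vertices, far enough apart for their images
    under [h1] to be far apart as well, decides the orientation of the quotient. *)
Lemma preserving_quotient phi h1 h2 h1' : coarse_line phi A ->
  is_iso h1 -> is_iso h2 -> is_iso h1' -> cancel h1 h1' ->
  far_preserving phi far_const h1 /\ far_preserving phi far_const h2 \/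
  far_reversing phi far_const h1 /\ far_reversing phi far_const h2 ->
  far_preserving phi far_const (h2 \o h1').
Proof.
move=> q i1 i2 i1' K1 or.
have [//|N] := iso_orientation q (iso_comp i2 i1').
exfalso; have [_ _ S] := q.
have [a Ha] := S 0%R; have [b Hb] := S (A + A + far_const2)%N%:Z%R.
have ab : (phi a + far_const%:Z <= phi b)%R.
  have : (far_const <= A * (A * far_const + A) + A)%N \/ A = 0%N.
    by case: (A) => [|A']; [right|left; nia].
  by rewrite /far_const2 in Hb; case=> [|A0]; [lia|rewrite /far_const /K0 /C A0 in Hb *; lia].
have far1 : (far_const < `|phi (h1 a) - phi (h1 b)|)%N.
  by apply: (iso_far q i1); lia.
case: or => -[o1 o2]; have lt1 := o1 _ _ ab; have lt2 := o2 _ _ ab.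
  by have := N (h1 a) (h1 b); rewrite /= !K1; lia.
by have := N (h1 b) (h1 a); rewrite /= !K1; lia.
Qed.

(** Consecutive images of [o] under the powers of [g] are as far apart as [o] and
    [g o], and their order is preserved; so they keep moving to the right, those
    under the inverse powers to the left. *)
Lemma translation_drift phi g g' o : coarse_line phi A -> is_iso g ->
  is_iso g' -> cancel g g' -> cancel g' g -> far_preserving phi far_const g ->
  (phi o + far_const2%:Z <= phi (g o))%R ->
  forall n, (phi o + n%:Z <= phi (iter n g o))%R /\
            (phi (iter n g' o) <= phi o - n%:Z)%R.
Proof.
move=> q gi gi' fK gK P lo n.
have far k : (far_const < `|phi (iter k.+1 g o) - phi (iter k g o)|)%N.
  by rewrite iterSr; apply: (iso_far q (iso_iter k gi)); lia.
have far' k : (far_const < `|phi (iter k g' o) - phi (iter k.+1 g' o)|)%N.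
  have := @iso_far _ (iter k.+1 g') (g o) o q (iso_iter _ gi').
  by rewrite [iter _ _ (g o)]iterSr fK; apply; lia.
have up k : (phi (iter k g o) + far_const%:Z <= phi (iter k.+1 g o))%R.
  elim: k => [|k IH]; first by have := far 0%N; rewrite /= in lo *; lia.
  by have := P _ _ IH; have := far k.+1; rewrite -!iterS; lia.
have dn k : (phi (iter k.+1 g' o) + far_const%:Z <= phi (iter k g' o))%R.
  have h0 : (phi (g' o) + far_const%:Z <= phi o)%R.
    rewrite leNgt; apply/negP => lt.
    have : (phi o + far_const%:Z <= phi (g' o))%R by have := far' 0%N; rewrite /=; lia.
    by move=> /P; rewrite gK; have := up 0%N; rewrite /=; lia.
  elim: k => // k IH; rewrite leNgt; apply/negP => lt.
  have : (phi (iter k.+1 g' o) + far_const%:Z <= phi (iter k.+2 g' o))%R.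
    by have := far' k.+1; lia.
  by move=> /P; rewrite [iter k.+2 _ _]iterS [iter k.+1 _ _]iterS !gK; move: IH; rewrite iterS; lia.
elim: n => [|n [IH1 IH2]]; first by rewrite /=; lia.
have := up n; have := dn n; rewrite /far_const /K0; lia.
Qed.

End CoarseLine.

Section EndsOfCoarseLines.
Context {G : graph} (cG : connected_graph G) (A : nat).
Implicit Types (phi : G -> int) (h : G -> G).

Lemma exists_translation phi : coarse_line phi A -> quasi_transitive G ->
  exists g g' o, [/\ is_iso g, is_iso g', cancel g g', cancel g' g &
    forall n, (phi o + n%:Z <= phi (iter n g o))%R /\
              (phi (iter n g' o) <= phi o - n%:Z)%R].
Proof.
move=> q qt; have [_ _ /choice[psi Hpsi]] := q.
(* coarse preimages of points that far apart are still [far_const2 A] apart *)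
pose T := (far_const2 A + A + A)%N.
pose u (n : nat) := psi (n * T)%N%:Z%R.
have uT m n : (m < n)%N -> (phi (u m) + (far_const2 A)%:Z <= phi (u n))%R.
  move=> mn; have := Hpsi (m * T)%N%:Z%R; have := Hpsi (n * T)%N%:Z%R; rewrite -/(u m) -/(u n).
  have : (m * T + T <= n * T)%N by rewrite -mulSnr leq_mul2r mn orbT.
  by rewrite {2}/T; lia.
have [i Hi] := orbit_recurrence u qt.
have [n1 [h1 [_ i1 e1]]] := Hi 0%N.
have [n2 [h2 [l2 i2 e2]]] := Hi n1.+1.
have [n3 [h3 [l3 i3 e3]]] := Hi n2.+1.
have quot m n f f' : (m < n)%N -> is_iso f -> is_iso f' ->
    f (u i) = u m -> f' (u i) = u n ->
    far_preserving phi (far_const A) f /\ far_preserving phi (far_const A) f' \/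
    far_reversing phi (far_const A) f /\ far_reversing phi (far_const A) f' ->
  exists g g' o, [/\ is_iso g, is_iso g', cancel g g', cancel g' g &
    forall n, (phi o + n%:Z <= phi (iter n g o))%R /\
              (phi (iter n g' o) <= phi o - n%:Z)%R].
  move=> mn fi fi' em en or.
  have [k [ki fk kf]] := iso_inv fi; have [k' [ki' fk' kf']] := iso_inv fi'.
  have K : cancel (f' \o k) (f \o k') by move=> x /=; rewrite fk' kf.
  have K' : cancel (f \o k') (f' \o k) by move=> x /=; rewrite fk kf'.
  have gi := iso_comp fi' ki; have gi' := iso_comp fi ki'.
  exists (f' \o k), (f \o k'), (u m); split => //.
  apply: (translation_drift cG q gi gi' K K' (preserving_quotient cG q fi fi' ki fk or)).
  by rewrite /= -em fk en em; exact: uT.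
have [o1|o1] := iso_orientation cG q i1; have [o2|o2] := iso_orientation cG q i2;
  have [o3|o3] := iso_orientation cG q i3.
- by apply: (quot n1 n2 h1 h2) => //; left.
- by apply: (quot n1 n2 h1 h2) => //; left.
- by apply: (quot n1 n3 h1 h3) => //; [lia|left].
- by apply: (quot n2 n3 h2 h3) => //; right.
- by apply: (quot n2 n3 h2 h3) => //; left.
- by apply: (quot n1 n3 h1 h3) => //; [lia|right].
- by apply: (quot n1 n2 h1 h2) => //; right.
- by apply: (quot n1 n2 h1 h2) => //; right.
Qed.

(** The translates of a walk from [o] to [g o] form an infinite walk, which
    contains a ray as the translates of [o] tend to infinity. *)
Lemma ray_of_translation phi g o : coarse_line phi A -> is_iso g ->
  (forall n, phi o + n%:Z <= phi (iter n g o))%R ->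
  exists r, is_ray r /\ tends_right phi r.
Proof.
move=> q gi drift.
have [[|z s] wp _] := gdist_walk cG o (g o).
  by case: wp => _ /= ego; have := drift 1%N; rewrite /= -ego; lia.
set Q := z :: s in wp *; set L := size Q.
have L0 : (0 < L)%N by [].
(* the translates, under the powers of [g], of the walk [o :: Q] in sequence *)
pose w n := iter (n %/ L) g (nth o (o :: Q) (n %% L)).
have wE k i : (i <= L)%N -> w (k * L + i)%N = iter k g (nth o (o :: Q) i).
  rewrite leq_eqVlt => /orP[/eqP->|iL].
    rewrite /w -mulSnr mulnK // modnMl iterSr /=; congr iter.
    by case: wp => _ <-; rewrite -nth_last.
  by rewrite /w divnMDl // divn_small // addn0 modnMDl modn_small.
have wa n : adj (w n) (w n.+1).
  have lt := ltn_pmod n L0.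
  rewrite (divn_eq n L) -addnS !wE //; last exact: ltnW.
  rewrite (iso_iter _ gi).2; have [/(pathP o) path_Q _] := wp.
  exact: path_Q.
pose B := (A * L + A)%N.
have wB n : (phi o + (n %/ L)%:Z - B%:Z <= phi (w n))%R.
  have d : (gdist (iter (n %/ L) g o) (w n) <= L)%N.
    rewrite (gdist_iso cG cG (iso_iter _ gi)).
    have lt := ltnW (ltn_pmod n L0); move: (n %% L)%N lt => i lt.
    apply: leq_trans (gdist_le cG (p := take i Q) _) _; last by rewrite size_takel.
    split; first by case: wp => wp _; exact: take_path.
    by rewrite -nth_last size_takel //; case: i lt => [|i] lt //; rewrite nth_take.
  have := coarse_upper q d; have := drift (n %/ L)%N; rewrite -/B; lia.
have wM M : exists N, forall n, (N <= n)%N -> (M <= phi (w n))%R.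
  exists (`|(M - phi o + B%:Z)%R| * L)%N => n; rewrite -leq_divRL // => le.
  by have := wB n; lia.
have [r [idx [ray Hr]]] : exists r (idx : nat -> nat),
    is_ray r /\ forall k, (k <= idx k)%N /\ r k = w (idx k).
  apply: ray_of_walk => // x; have [N HN] := wM (phi x + 1)%R.
  by exists N => n /HN + e; rewrite e; lia.
exists r; split => // M; have [N HN] := wM M; exists N => n Nn.
by have [le ->] := Hr n; apply: HN; exact: leq_trans le.
Qed.

(** In the absence of dominated ends a ray cannot turn back infinitely often, as
    it would have to pass through a bounded set each time. *)
Lemma ray_tends phi r : coarse_line phi A -> no_dominated_end G -> is_ray r ->
  tends_right phi r \/ tends_right (fun x => - phi x)%R r.
Proof.
move=> q nd ray; have o := r 0%N.
have far M : exists N, forall n, (N <= n)%N -> (M < `|phi (r n)|)%N.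
  have [N HN] := ray_leaves_ball cG o (A * (M + `|phi o|) + A) nd ray.
  exists N => n /HN; rewrite !ltnNge; apply: contra => le.
  by apply: (coarse_lower q); lia.
have step n : (`|phi (r n) - phi (r n.+1)| <= A + A)%N.
  by apply: (coarse_adj cG q); case: ray.
have [N HN] := far (A + A)%N.
have sgn k : (0 < phi (r (N + k)%N))%R = (0 < phi (r N))%R.
  elim: k => [|k <-]; first by rewrite addn0.
  have := HN (N + k)%N (leq_addr _ _); have := HN (N + k.+1)%N (leq_addr _ _).
  by rewrite addnS; have := step (N + k)%N; lia.
have [pos|neg] := boolP (0 < phi (r N))%R; [left|right] => M.
  have [N' HN'] := far `|M|%N; exists (maxn N N') => n le.
  have := sgn (n - N)%N; rewrite subnKC; last by lia.
  by have := HN' n; lia.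
have [N' HN'] := far `|M|%N; exists (maxn N N') => n le.
have := sgn (n - N)%N; rewrite subnKC; last by lia.
by have := HN' n; lia.
Qed.

(** Two rays tending to the same side come close to each other infinitely often,
    farther out than any given finite set. *)
Lemma tends_right_equiv phi r r' : coarse_line phi A ->
  is_ray r -> is_ray r' -> tends_right phi r -> tends_right phi r' ->
  ray_equiv r r'.
Proof.
move=> q ray ray' tr tr'; apply/ray_equivP => // S fS.
apply/eventually_joinedP => //; have [[o _] _] := cG.
have [D HD] := finite_set_bounded_gdist o fS.
have [N HN] := reach_tail ray fS; have [N' HN'] := reach_tail ray' fS.
(* bounds the distance of two vertices whose images are at most [2 * A] apart *)
pose E := (A * (A + A) + A)%N.
have [n1 Hn1] := tr (Num.max (phi (r' N')) (phi o + (A * D + A)%N%:Z + (A * E + A)%N%:Z + 1))%R.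
pose n := maxn N n1; have /Hn1 rn : (n1 <= n)%N by lia.
have [m' Hm'] := tr' (phi (r n)).
have [m [N'm close]] : exists m, (N' <= m)%N /\ (`|phi (r n) - phi (r' m)| <= A + A)%N.
  have ex : exists m, (N' <= m)%N && (phi (r n) <= phi (r' m))%R.
    by exists (maxn m' N'); rewrite leq_maxr Hm' // leq_maxl.
  have [m /andP[N'm le] mm] := ex_minnP ex; exists m; split => //.
  move: N'm; rewrite leq_eqVlt => /orP[/eqP em|lt]; first by rewrite -em in le *; lia.
  case: m lt le mm => // m lt le mm.
  have : ~~ ((N' <= m)%N && (phi (r n) <= phi (r' m))%R).
    by apply/negP => /mm; rewrite ltnn.
  have : adj (r' m) (r' m.+1) by case: ray'.
  by move=> /(coarse_adj cG q); lia.
exists (r n); split; first by apply: HN; lia.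
apply: (reach_joined (y := r' m)); last exact: HN'.
apply: (geodesic_joined cG) => z le Sz.
have d1 : (gdist (r n) z <= E)%N by have := coarse_lower q close; rewrite -/E; lia.
have := coarse_upper q d1; have := coarse_upper q (HD _ Sz); lia.
Qed.

(** If two rays tending to different sides were equivalent, then every finite set
    could be avoided by a walk from one side to the other; such a walk passes
    through a fixed bounded set, and so the end would be dominated. *)
Lemma tends_opposite_inequiv phi r r' : coarse_line phi A ->
  no_dominated_end G -> is_ray r -> is_ray r' ->
  tends_right phi r -> tends_right (fun x => - phi x)%R r' -> ~ ray_equiv r r'.
Proof.
move=> q nd ray ray' tr tr' /(ray_equivP ray ray') e.
have [[o _] _] := cG.
apply: (nd (end_of r)); first by exists r.
apply: (dominated_of_bounded cG ray (o := o) (D := A * (A + A + `|phi o|) + A)) => F fF.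
have [N HN] := e F fF; have [n1 Hn1] := tr 1%R; have [n2 Hn2] := tr' 0%R.
pose n := maxn N (maxn n1 n2).
have j : joined_in (~` F) (r' n) (r n) by apply: joined_sym; apply: HN; lia.
(* the walk cannot jump over the slab within distance [2 * A] of 0 *)
pose mid := exists m, (`|phi m| <= A + A)%N /\ joined_in (~` F) (r' n) m.
have r1 : (1 <= phi (r n))%R by apply: Hn1; lia.
have r2 : (0 <= - phi (r' n))%R by apply: Hn2; lia.
have [|[m [ml jm]]] : (phi (r n) <= 0)%R \/ mid.
    apply: (joined_ind (P := fun x => (phi x <= 0)%R \/ mid) j); first by left; lia.
    move=> u v Fu Fv uv ju [u0|]; last by right.
    have := coarse_adj cG q uv => st.
    have [v0|v0] := leP (phi v) 0%R; [by left|right; exists v; split; first by lia].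
    by apply: (joined_trans ju); exact: joined_adj.
  by lia.
exists m; first by apply: (coarse_lower q); lia.
apply: (reach_joined (y := r n)); first exact: joined_trans (joined_sym jm) j.
have [M HM] := ray_tail ray fF; have nr : joined_in (~` F) (r n) (r' n) := joined_sym j.
exists (maxn N M) => k Nk; apply: joined_trans nr (joined_sym _).
by apply: HN; lia.
Qed.

Lemma coarse_line_two_ended phi : coarse_line phi A -> quasi_transitive G ->
  no_dominated_end G -> two_ended G.
Proof.
move=> q qt nd; have [g [g' [o [gi gi' gK gK' drift]]]] := exists_translation q qt.
have [r [ray tr]] := ray_of_translation q gi (fun n => (drift n).1).
have q' := coarse_line_opp q.
have [r' [ray' tr']] : exists r, is_ray r /\ tends_right (fun x => - phi x)%R r.
  by apply: (ray_of_translation q' gi' (o := o)) => n; have := (drift n).2; lia.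
apply/two_endedP; exists r, r'; split => //.
  exact: (tends_opposite_inequiv q).
move=> s ys; have [ts|ts] := ray_tends q nd ys; [left|right].
  exact: (tends_right_equiv q).
exact: (tends_right_equiv q').
Qed.

End EndsOfCoarseLines.

(** * Quasi-isometries to the double ray *)

Lemma double_ray_shift (i : double_ray) (n : nat) :
  joined_in [set: double_ray] i (i + n%:Z)%R.
Proof.
elim: n => [|n IH]; first by rewrite addr0; exact: joined_refl.
apply: (joined_trans IH); apply: joined_adj => //=; rewrite /dray_adj; lia.
Qed.

Lemma connected_double_ray : connected_graph double_ray.
Proof.
split; first by exists (0%R : int).
move=> i j _ _; have [le|/ltW le] := lerP i j.
  by have := double_ray_shift i `|j - i|%N; congr joined_in; lia.
by apply: joined_sym; have := double_ray_shift j `|i - j|%N; congr joined_in; lia.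
Qed.

Lemma gdist_double_ray (i j : double_ray) : gdist i j = `|i - j|%N.
Proof.
have c := connected_double_ray.
have up (k : double_ray) (n : nat) : (gdist k (k + n%:Z)%R <= n)%N.
  elim: n => [|n IH]; first by rewrite addr0 gdistxx.
  have : adj ((k + n%:Z)%R : double_ray) (k + n.+1%:Z)%R by rewrite /= /dray_adj; lia.
  move=> /(gdist_adj c); have := gdist_tri c (k + n%:Z)%R k (k + n.+1%:Z)%R; lia.
apply/eqP; rewrite eqn_leq; apply/andP; split.
  have [le|/ltW le] := lerP i j.
    have := up i `|j - i|%N; have -> : (i + `|j - i|%N%:Z = j)%R by lia.
    lia.
  rewrite (gdist_sym c); have := up j `|i - j|%N.
  have -> : (j + `|i - j|%N%:Z = i)%R by lia.
  lia.
have := @gdist_lipschitz _ c id 1 _ i j; rewrite mul1n; apply.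
by move=> x y /eqP /= ->.
Qed.

Lemma quasi_isometric_double_ray (R : realType) (G : graph) :
  quasi_isometric R G double_ray <->
  exists (phi : G -> int) A, coarse_line phi A.
Proof.
split=> [[f [[l l1 fl] [l' fl']]]|[f [A [U L S]]]].
- have l0 : (0 < l)%R by lra.
  pose A := Num.bound (l ^+ 2 + l + `|l'|)%R.
  have : (l ^+ 2 + l + `|l'| < A%:R)%R.
    apply: archi_boundP; have := normr_ge0 l'; have := sqr_ge0 l; lra.
  have l2 := sqr_ge0 l; have nl' := normr_ge0 l'; have ll' := ler_norm l' => lA.
  exists f, A; split=> [x y|x y|n].
  + have /andP[_] := fl x y; rewrite gdist_double_ray => h.
    rewrite -(ler_nat R) natrD natrM; apply: (le_trans h).
    have d0 : (0 <= (gdist x y)%:R :> R)%R by exact: ler0n.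
    by apply: lerD; [apply: ler_wpM2r => //; lra|lra].
  + have /andP[h _] := fl x y; rewrite gdist_double_ray in h.
    rewrite -(ler_nat R) natrD natrM.
    move: h; rewrite lerBlDr mulrC ler_pdivrMr // => h; apply: (le_trans h).
    have d0 : (0 <= (`|f x - f y|%N)%:R :> R)%R by exact: ler0n.
    have : (l * (`|f x - f y|%N)%:R <= A%:R * (`|f x - f y|%N)%:R)%R.
      by apply: ler_wpM2r => //; lra.
    by rewrite mulrDl -expr2 [(_ * l)%R]mulrC; lra.
  + have [x] := fl' n; rewrite gdist_double_ray => h; exists x.
    by rewrite -(ler_nat R); lra.
- exists f; pose l := (A.+1%:R : R)%R.
  have l1 : (1 <= l)%R by rewrite /l ler1n.
  split.
  + exists l => // x y; rewrite gdist_double_ray; apply/andP; split.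
      rewrite lerBlDr mulrC ler_pdivrMr; last by lra.
      have : (A * `|f x - f y| + A <= (`|f x - f y| + A.+1) * A.+1)%N by nia.
      move/(leq_trans (L x y)); rewrite -(ler_nat R) natrM natrD; exact.
    have : (A * gdist x y + A <= A.+1 * gdist x y + A.+1)%N by nia.
    by move/(leq_trans (U x y)); rewrite -(ler_nat R) natrD natrM.
  + exists A%:R%R => n; have [x h] := S n; exists x.
    by rewrite gdist_double_ray ler_nat.
Qed.

(** * Tree-amalgamations over the double ray *)

Lemma coarse_line_iso (G H : graph) (f : H -> G) (phi : H -> int) A :
  connected_graph G -> connected_graph H -> is_iso f ->
  coarse_line phi A -> exists psi : G -> int, coarse_line psi A.
Proof.
move=> cG cH fi [U L S]; have [g [gi fK gK]] := iso_inv fi.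
exists (phi \o g); split=> [x y|x y|n] /=.
- by rewrite -(gdist_iso cG cH gi); exact: U.
- by rewrite -(gdist_iso cG cH gi); exact: L.
- by have [x] := S n; exists (f x); rewrite fK.
Qed.

(* the gluing relation of tree-amalgamations, not the gluing of functions *)
Local Notation glue := Defs.glue.

Section AmalgamIsLine.
Context {G1 G2 : graph} (D : amalgam_data G1 G2).
Hypothesis disjoint1 : adh1 D false `&` adh1 D true = set0.
Hypothesis disjoint2 : adh2 D false `&` adh2 D true = set0.

Definition copy_index (u : @copies G1 G2) : int :=
  match u with inl (s, _) => sval s | inr (t, _) => sval t end.

Lemma glue_index u v : glue D u v -> `|copy_index u - copy_index v|%N = 1%N.
Proof. by case=> s t x /eqP. Qed.

Lemma glue_functional u v v' : glue D u v -> glue D u v' -> v = v'.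
Proof.
case=> s t x st Sx g; inversion g as [s' t' x' st' Sx' es et]; subst s' x'.
have [-> //|ne] := pselect (t = t').
have := @lbl_V1 _ _ D _ _ _ st st' ne; move: Sx Sx'.
have no y : adh1 D false y -> adh1 D true y -> False.
  by move=> y0 y1; have : (adh1 D false `&` adh1 D true) y by []; rewrite disjoint1.
by case: (lbl D s t).1; case: (lbl D s t').1 => // y0 y1; [case: (no _ y1 y0)|case: (no _ y0 y1)].
Qed.

Lemma glue_injective u u' v : glue D u v -> glue D u' v -> u = u'.
Proof.
case=> s t x st Sx g.
inversion g as [s' t' x' st' Sx' es [et ei]]; subst t'.
have := idmap_bij D (lbl D s t).1 (lbl D s t).2.
have := idmap_bij D (lbl D s' t).1 (lbl D s' t).2.
have [ss|ne] := pselect (s = s').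
  subst s' => _ [_ inj _]; congr (inl (_, _)); apply: inj; rewrite ?inE //.
move=> [im' _ _] [im _ _].
have := @lbl_V2 _ _ D _ _ _ st st' ne; move: (im _ Sx) (im' _ Sx'); rewrite ei.
have no y : adh2 D false y -> adh2 D true y -> False.
  by move=> y0 y1; have : (adh2 D false `&` adh2 D true) y by []; rewrite disjoint2.
by case: (lbl D s t).2; case: (lbl D s' t).2 => // y0 y1; [case: (no _ y1 y0)|case: (no _ y0 y1)].
Qed.

(** Since the two adhesions of each copy are disjoint, at most two vertices of
    the disjoint union are identified at a time. *)
Lemma glue_classE u v : glue_class D u v -> [\/ u = v, glue D u v | glue D v u].
Proof.
elim=> {u v} [u v|u|u v _|u v w _ IH1 _ IH2].
- by constructor 2.
- by constructor 1.
- by case; [constructor 1|constructor 3|constructor 2].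
case: IH1 IH2 => [->//|g|g] [<-|g'|g'].
- by constructor 2.
- by inversion g; subst; inversion g'.
- by rewrite (glue_injective g g'); constructor 1.
- by constructor 3.
- by rewrite (glue_functional g g'); constructor 1.
- by inversion g; subst; inversion g'.
Qed.

Lemma glue_class_index u v : glue_class D u v ->
  (`|copy_index u - copy_index v| <= 1)%N.
Proof.
case/glue_classE=> [->|/glue_index|/glue_index]; lia.
Qed.

(** A glued vertex has two indices, which differ by one; one of them is chosen. *)
Definition level (a : amalgam D) : int := copy_index (sval (cid (svalP a))).

Lemma level_mem (a : amalgam D) u : sval a u ->
  (`|level a - copy_index u| <= 1)%N.
Proof.
rewrite /level; case: cid => v /= ->; exact: glue_class_index.
Qed.

Lemma level_adj (a b : amalgam D) : adj a b -> (`|level a - level b| <= 2)%N.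
Proof.
move=> /asboolP[_ [u [v [au bv uv]]]].
have := level_mem au; have := level_mem bv.
have -> : copy_index u = copy_index v; last by lia.
by case: u v uv {au bv} => [[s x]|[s x]] [[s' x']|[s' x']] //= [->].
Qed.

Lemma proj_rep (a : amalgam D) : amalgam_proj D (sval (cid (svalP a))) = a.
Proof.
case: cid => u e; case: a e => A hA /= e; apply: eq_exist; exact/esym.
Qed.

Lemma proj_glue u v : glue D u v -> amalgam_proj D u = amalgam_proj D v.
Proof.
move=> g; apply: eq_exist; apply/seteqP; split=> w h.
  by apply: rst_trans h; apply: rst_sym; exact: rst_step.
by apply: rst_trans h; exact: rst_step.
Qed.

Lemma proj_adj u v : copies_adj u v ->
  amalgam_proj D u = amalgam_proj D v \/
  adj (amalgam_proj D u : amalgam D) (amalgam_proj D v).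
Proof.
move=> uv; have [e|ne] := pselect (amalgam_proj D u = amalgam_proj D v).
  by left.
by right; apply/asboolP; split => //; exists u, v; split => //; exact: rst_refl.
Qed.

Hypothesis adh_nonempty : forall k, adh1 D k !=set0.

Lemma edge_glued (i j : int) : `|i - j|%N = 1%N -> exists a b,
  [/\ copy_index a = i, copy_index b = j & amalgam_proj D a = amalgam_proj D b].
Proof.
have even (k l : int) : `|k - l|%N = 1%N -> ~~ odd `|k|%N -> exists a b,
    [/\ copy_index a = k, copy_index b = l & amalgam_proj D a = amalgam_proj D b].
  move=> kl ek; have ol : odd `|l|%N by lia.
  pose s : V1 := exist _ (k : double_ray) ek.
  pose t : V2 := exist _ (l : double_ray) ol.
  have [x Sx] := adh_nonempty (lbl D s t).1.
  exists (inl (s, x)), (inr (t, idmap D (lbl D s t).1 (lbl D s t).2 x)); split => //.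
  by apply: proj_glue; constructor => //; apply/eqP.
move=> ij; have [ei|oi] := boolP (~~ odd `|i|%N); first exact: even.
have [|| b [a [eb ea e]]] := even j i; [by lia|by lia|].
by exists a, b.
Qed.

Hypotheses (c1 : connected_graph G1) (c2 : connected_graph G2).
Hypothesis cA : connected_graph (amalgam D).
Variable d : nat.
Hypothesis diam1 : forall x y : G1, (gdist x y <= d)%N.
Hypothesis diam2 : forall x y : G2, (gdist x y <= d)%N.

Lemma gdist_same_copy u v : copy_index u = copy_index v ->
  (gdist (amalgam_proj D u : amalgam D) (amalgam_proj D v) <= d)%N.
Proof.
case: u v => [[s x]|[s x]] [[t y]|[t y]] /= e.
- have <- : s = t by apply: val_inj.
  apply: leq_trans (diam1 x y).
  apply: (gdist_hom (f := fun x => copy1 D s x)) => // a b ab; exact: proj_adj.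
- by exfalso; have := svalP s; have := svalP t; rewrite /= e => ->.
- by exfalso; have := svalP s; have := svalP t; rewrite /= e => /negP.
- have <- : s = t by apply: val_inj.
  apply: leq_trans (diam2 x y).
  apply: (gdist_hom (f := fun x => copy2 D s x)) => // a b ab; exact: proj_adj.
Qed.

Lemma gdist_copies u v :
  (gdist (amalgam_proj D u : amalgam D) (amalgam_proj D v) <=
   d * (`|copy_index u - copy_index v|%N).+1)%N.
Proof.
move: {2}`|_|%N (erefl `|copy_index u - copy_index v|%N) => n.
elim: n u => [|n IH] u e.
  by rewrite e muln1; apply: gdist_same_copy; lia.
have [j [j1 j2]] : exists j : int, `|copy_index u - j|%N = 1%N /\
    `|j - copy_index v|%N = n.
  have [le|le] := leP (copy_index u) (copy_index v).
    by exists (copy_index u + 1)%R; lia.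
  by exists (copy_index u - 1)%R; lia.
have [a [b [ea eb ab]]] := edge_glued j1.
have := IH b; rewrite eb j2 => /(_ erefl) le.
have ua : (gdist (amalgam_proj D u : amalgam D) (amalgam_proj D a) <= d)%N.
  by apply: gdist_same_copy; rewrite ea.
have := gdist_tri cA (amalgam_proj D a) (amalgam_proj D u) (amalgam_proj D v).
by rewrite {2}ab e mulnS; lia.
Qed.

(** Passing to the next copy costs at most the diameter of a copy, and an edge
    changes the copy by at most two. *)
Lemma amalgam_coarse_line : coarse_line level d.+2.
Proof.
split=> [a b|a b|n].
- have := gdist_lipschitz cA level_adj a b.
  by rewrite !mulSn; lia.
- rewrite -{1}(proj_rep a) -{1}(proj_rep b); apply: leq_trans (gdist_copies _ _) _.
  by rewrite -/(level a) -/(level b) mulnS !mulSn; lia.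
- have [|a [_ [ea _ _]]] := @edge_glued n (n + 1)%R; first by lia.
  exists (amalgam_proj D a); have : sval (amalgam_proj D a) a by exact: rst_refl.
  by move/level_mem; rewrite ea; lia.
Qed.

End AmalgamIsLine.

Lemma splitting_coarse_line (G : graph) : connected_graph G ->
  splits_strongly_thin G -> exists (phi : G -> int) A, coarse_line phi A.
Proof.
move=> cG [Gb [D [f [fi _ [cb _ [d diam]] _ [adh [dis1 dis2 _]]]]]].
have [g [gi fK gK]] := iso_inv fi.
have cA : connected_graph (amalgam D).
  rewrite /connected_graph; suff <- : g @` [set: G] = [set: amalgam D].
    exact: iso_connected_set.
  by apply/seteqP; split => // a _; exists (f a).
have ne k : adh1 D k !=set0.
  by have [|_ []] := adh (adh1 D k); first by left; exists k.
have [psi] := coarse_line_iso cG cA fi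
  (amalgam_coarse_line dis1 dis2 ne cb cb cA diam diam).
by exists psi, d.+2.
Qed.

(** * Cutting a graph along the translates of a separator *)

Section Powers.
Context {G : graph} (g g' : G -> G).
Hypotheses (gi : is_iso g) (gi' : is_iso g') (fK : cancel g g') (gK : cancel g' g).

Definition zpow (n : int) : G -> G :=
  match n with Posz k => iter k g | Negz k => iter k.+1 g' end.

Lemma zpowS n x : zpow (n + 1)%R x = g (zpow n x).
Proof.
case: n => n; first by rewrite -PoszD addn1.
case: n => [|n]; first by rewrite /= gK.
have -> : (Negz n.+1 + 1 = Negz n)%R by lia.
by rewrite /= gK.
Qed.

Lemma zpowP n x : zpow (n - 1)%R x = g' (zpow n x).
Proof. by rewrite -{2}(subrK 1%R n) zpowS fK. Qed.

Lemma zpowD m n x : zpow (m + n)%R x = zpow m (zpow n x).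
Proof.
elim: m => [|m IH|m IH]; first by rewrite add0r.
  by rewrite -addn1 PoszD addrAC !zpowS IH.
rewrite -addn1 PoszD opprD -addrAC.
by rewrite zpowP IH -zpowP.
Qed.

Lemma zpowNK n x : zpow (- n)%R (zpow n x) = x.
Proof. by rewrite -zpowD addNr. Qed.

Lemma zpowKN n x : zpow n (zpow (- n)%R x) = x.
Proof. by rewrite -zpowD addrN. Qed.

Lemma zpow_iso n : is_iso (zpow n).
Proof. by case: n => n; apply: iso_iter. Qed.

End Powers.

Section Slicing.
Context {G : graph} (cG : connected_graph G) (g g' : G -> G).
Hypotheses (gi : is_iso g) (gi' : is_iso g') (fK : cancel g g') (gK : cancel g' g).
Variables B S : set G.
Hypotheses (finS : finite_set S) (conS : connected_set S) (SB : S `<=` B).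
Hypothesis bdB : forall x y, B x -> ~ B y -> adj x y -> S x.
Hypothesis Bg : forall x, B x -> B (g' x).
Hypothesis Sg : forall x, S x -> ~ B (g x).

Local Notation zpow := (zpow g g').

(** The part between [S] and its image under [g], both included: the translate of
    [B] by [g] without [B], but with [S]. *)
Definition slice : set G := [set x | B (g' x) /\ (B x -> S x)].

Lemma slice_S x : S x -> slice x.
Proof. by move=> Sx; split => // ; apply/Bg/SB. Qed.

Lemma slice_gS x : S (g' x) -> slice x.
Proof. by move=> Sx; split; [exact: SB|have := Sg Sx; rewrite gK]. Qed.

Lemma neighbour_B x y : adj x y -> B x -> B (g' y).
Proof.
move=> xy Bx; have [By|nBy] := pselect (B y); first exact: Bg.
apply: contrapT => nB; have := bdB (Bg Bx) nB.
by rewrite gi'.2 => /(_ xy)/Sg; rewrite gK.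
Qed.

(** [below n] is the translate of [B] by the [n]-th power of [g]. *)
Definition below (n : int) x := B (zpow (- n)%R x).

Lemma below_succ n x : below n x -> below (n + 1)%R x.
Proof. by rewrite /below opprD zpowP //; exact: Bg. Qed.

Lemma below_mono m n x : (m <= n)%R -> below m x -> below n x.
Proof.
move=> le; have -> : (n = m + `|n - m|%N%:Z)%R by lia.
elim: (`|n - m|%N) => [|k IH]; first by rewrite addr0.
by move=> /IH/below_succ; congr below; lia.
Qed.

Lemma below_adj n x y : adj x y -> below n x -> below (n + 1)%R y.
Proof.
move=> xy; rewrite /below opprD zpowP //; apply: neighbour_B.
by rewrite (zpow_iso gi gi' _).2.
Qed.

Lemma below_S n s : S s -> below n (zpow n s) /\ ~ below (n - 1)%R (zpow n s).
Proof.
move=> Ss; split; first by rewrite /below zpowNK //; exact: SB.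
by rewrite /below opprB addrC zpowS // zpowNK //; exact: Sg.
Qed.

(** The neighbours of a translate of [B] lie in the next translate.  So a walk
    from [S] to [x] passes only finitely many translates: their union is the whole
    graph and their intersection is empty. *)
Lemma level_exists x : exists n, below (n + 1)%R x /\ ~ below n x.
Proof.
have [[s Ss] _] := conS; have [b0 nb0] := below_S 0%R Ss.
have [a ba] : exists n, below n x.
  apply: (joined_ind (P := fun x => exists n, below n x) (connectedE cG s x)).
    by exists 0%R.
  by move=> u v _ _ uv _ [n bn]; exists (n + 1)%R; exact: below_adj bn.
have [b nb] : exists n, ~ below n x.
  apply: (joined_ind (P := fun x => exists n, ~ below n x) (connectedE cG s x)).
    by exists (0 - 1)%R.
  move=> u v _ _ uv _ [n bn]; exists (n - 1)%R => bv; apply: bn.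
  by rewrite -(subrK 1%R n); apply: below_adj bv; rewrite adj_sym.
have ex : exists k : nat, `[< below (b + k%:Z)%R x >].
  exists `|a - b|%N; apply/asboolP; apply: below_mono ba; lia.
have [[|k] /asboolP bk mk] := ex_minnP ex; first by rewrite addr0 in bk.
exists (b + k%:Z)%R; split; first by move: bk; congr below; lia.
by move/asboolP/mk; rewrite ltnn.
Qed.

Lemma slice_level n x : below (n + 1)%R x -> ~ below n x -> slice (zpow (- n)%R x).
Proof. by rewrite /below opprD zpowP // => b nb; split. Qed.

Lemma below_slice n x : slice (zpow (- n)%R x) -> below (n + 1)%R x.
Proof. by rewrite /below opprD zpowP // => -[]. Qed.

(** An edge between two levels leaves a translate of [B], so its lower end lies in
    the translate of [S] that belongs to the slice of the upper end. *)
Lemma adj_slice x y : adj x y ->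
  exists n, slice (zpow (- n)%R x) /\ slice (zpow (- n)%R y).
Proof.
have sub u v m n : adj u v -> (m < n)%R -> below (n + 1)%R u -> ~ below n u ->
    below (m + 1)%R v -> exists n, slice (zpow (- n)%R u) /\ slice (zpow (- n)%R v).
  move=> uv mn bu nbu bv; exists n; split; first exact: slice_level.
  apply: slice_S; apply: (bdB _ nbu); last by rewrite (zpow_iso gi gi' _).2 adj_sym.
  by apply: below_mono bv; lia.
move=> xy; have [n [bx nbx]] := level_exists x; have [m [by_ nby]] := level_exists y.
have [mn|nm|e] := ltgtP m n.
- exact: (sub x y m n).
- have [|k [h1 h2]] := @sub y x n m _ nm by_ nby bx; first by rewrite adj_sym.
  by exists k.
- by subst m; exists n; split; exact: slice_level.
Qed.

(** A vertex common to two translates of the slice lies below the later one, hence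
    in its near end; and the near end of a slice meets no slice before the previous
    one.  So the copies overlap exactly where the amalgamation glues them. *)
Lemma slice_overlap m n w w' : slice w -> slice w' -> (m < n)%R ->
  zpow n w = zpow m w' -> [/\ n = (m + 1)%R, S w & w' = g w].
Proof.
move=> sw sw' mn e.
have b1 : below (m + 1)%R (zpow n w) by rewrite e; apply: below_slice; rewrite zpowNK.
have Sw : S w.
  apply: sw.2; rewrite -(zpowNK fK gK n w); apply: below_mono b1; lia.
have nm : (n = m + 1)%R.
  have [_ nb] := below_S n Sw; have [lt|lt|//] := ltgtP n (m + 1)%R.
    by lia.
  by exfalso; apply: nb; apply: below_mono b1; lia.
split => //; rewrite -(zpowNK fK gK m w') -e nm zpowD // zpowNK //.
Qed.

Definition slice_adj : rel {x | slice x} := fun x y => adj (sval x) (sval y).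

Lemma slice_adj_sym : symmetric slice_adj.
Proof. by move=> x y; rewrite /slice_adj adj_sym. Qed.

Lemma slice_adj_irr : irreflexive slice_adj.
Proof. by move=> x; rewrite /slice_adj adj_irr. Qed.

Definition slice_graph : graph := Graph slice_adj_sym slice_adj_irr.

Lemma slice_inj (x y : slice_graph) : sval x = sval y -> x = y.
Proof. by case: x y => [x hx] [y hy] /= e; exact: eq_exist. Qed.

(** [d] is a default value, for arguments outside the slice. *)
Definition to_slice (d : slice_graph) (x : G) : slice_graph :=
  if pselect (slice x) is left h then exist _ x h else d.

Lemma to_sliceK d x : slice x -> sval (to_slice d x) = x.
Proof. by rewrite /to_slice; case: pselect. Qed.

(** The label [false] stands for [S], at the near end of the slice, and [true] for
    its image under [g], at the far end. *)
Definition slice_adh (k : bool) : set slice_graph :=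
  [set x | if k then S (g' (sval x)) else S (sval x)].

(** Each copy is glued at its far end to the near end of the next copy. *)
Definition slice_label (s : V1) (t : V2) : bool * bool :=
  if sval t == (sval s + 1)%R then (true, false) else (false, true).

(** Only the labels [(true, false)] and [(false, true)] occur on edges. *)
Definition slice_idmap (k l : bool) (x : slice_graph) : slice_graph :=
  match k, l with
  | true, false => to_slice x (g' (sval x))
  | false, true => to_slice x (g (sval x))
  | _, _ => x
  end.

Lemma slice_label_V1 (s : V1) (t t' : V2) : adj (sval s) (sval t) ->
  adj (sval s) (sval t') -> t <> t' -> (slice_label s t).1 <> (slice_label s t').1.
Proof.
move=> /eqP st /eqP st' tt'; rewrite /slice_label.
have ne : sval t <> sval t' by move=> e; apply: tt'; exact: val_inj.
by case: eqP => e1; case: eqP => e2 //= _; apply: ne; lia.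
Qed.

Lemma slice_label_V2 (t : V2) (s s' : V1) : adj (sval s) (sval t) ->
  adj (sval s') (sval t) -> s <> s' -> (slice_label s t).2 <> (slice_label s' t).2.
Proof.
move=> /eqP st /eqP st' ss'; rewrite /slice_label.
have ne : sval s <> sval s' by move=> e; apply: ss'; exact: val_inj.
by case: eqP => e1; case: eqP => e2 //= _; apply: ne; lia.
Qed.

Lemma sval_idmap_tf x : slice_adh true x ->
  sval (slice_idmap true false x) = g' (sval x).
Proof. by move=> Sx; apply: to_sliceK; exact: slice_S. Qed.

Lemma sval_idmap_ft x : slice_adh false x ->
  sval (slice_idmap false true x) = g (sval x).
Proof. by move=> Sx; apply: to_sliceK; apply: slice_gS; rewrite fK. Qed.

Lemma slice_idmap_bij k l :
  set_bij (slice_adh k) (slice_adh l) (slice_idmap k l).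
Proof.
have idb (A : set slice_graph) : set_bij A A id.
  by split=> [x|x y _ _|x Ax] //; exists x.
case: k l => [] []; [exact: idb| | |exact: idb]; split.
- by move=> x Sx; rewrite /slice_adh /= sval_idmap_tf.
- move=> x y; rewrite !inE => Sx Sy /(congr1 sval).
  by rewrite !sval_idmap_tf // => /(can_inj gK)/slice_inj.
- move=> y Sy; have h : slice (g (sval y)) by apply: slice_gS; rewrite fK.
  have Sx : slice_adh true (exist _ (g (sval y)) h) by rewrite /slice_adh /= fK.
  exists (exist _ (g (sval y)) h) => //.
  by apply: slice_inj; rewrite sval_idmap_tf //= fK.
- by move=> x Sx; rewrite /slice_adh /= sval_idmap_ft //= fK.
- move=> x y; rewrite !inE => Sx Sy /(congr1 sval).
  by rewrite !sval_idmap_ft // => /(can_inj fK)/slice_inj.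
- move=> y Sy; have h : slice (g' (sval y)) by exact: slice_S.
  exists (exist _ (g' (sval y)) h) => //.
  by apply: slice_inj; rewrite sval_idmap_ft //= gK.
Qed.

Definition slice_data : amalgam_data slice_graph slice_graph :=
  AmalgamData slice_label_V1 slice_label_V2 slice_idmap_bij.

Local Notation copies := (@copies slice_graph slice_graph).

(** The copy with index [n] is the translate of the slice by the [n]-th power. *)
Definition place (u : copies) : G :=
  match u with
  | inl (s, x) => zpow (sval s) (sval x)
  | inr (t, y) => zpow (sval t) (sval y)
  end.

Definition copy_point (u : copies) : slice_graph :=
  match u with inl (_, x) => x | inr (_, y) => y end.

Lemma placeE u : place u = zpow (copy_index u) (sval (copy_point u)).
Proof. by case: u => -[]. Qed.

Lemma place_glue u v : Defs.glue slice_data u v -> place u = place v.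
Proof.
case=> s t x /eqP st /=; rewrite /slice_label; case: eqP => [e|ne] /= Sx.
  by rewrite to_sliceK ?e; [rewrite zpowD //= gK|exact: slice_S].
have -> : sval t = (sval s - 1)%R by lia.
rewrite to_sliceK; last by apply: slice_gS; rewrite fK.
by rewrite zpowD //= fK.
Qed.

Lemma place_class u v : glue_class slice_data u v -> place u = place v.
Proof.
by elim=> [a b /place_glue|//|a b _ ->|a b c _ -> _ ->].
Qed.

Lemma odd_absz_succ (i j : int) : i = (j + 1)%R -> odd `|i|%N = ~~ odd `|j|%N.
Proof. lia. Qed.

Lemma succ_asym (i j : int) : i = (j + 1)%R -> j = (i + 1)%R -> False.
Proof. lia. Qed.

Lemma glue_of_overlap u v : (copy_index v < copy_index u)%R ->
  place u = place v -> glue_class slice_data u v.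
Proof.
move=> lt; rewrite !placeE => /(slice_overlap (svalP _) (svalP _) lt).
case: u v lt => [[s w]|[s w]] [[t w']|[t w']] /= lt [e Sw ew].
- by have := odd_absz_succ e; rewrite (negbTE (svalP s)) (svalP t).
- have st : adj (sval s) (sval t) by rewrite /= /dray_adj; lia.
  have lst : slice_label s t = (false, true).
    by rewrite /slice_label; case: eqP => // e'; have := succ_asym e e'.
  have -> : w' = idmap slice_data (lbl slice_data s t).1 (lbl slice_data s t).2 w.
    by rewrite /= lst; apply: slice_inj; rewrite sval_idmap_ft.
  by apply: rst_step; constructor => //=; rewrite lst.
- have st : adj (sval t) (sval s) by rewrite /= /dray_adj; lia.
  have lst : slice_label t s = (true, false) by rewrite /slice_label e eqxx.
  have Sw' : slice_adh true w' by rewrite /slice_adh /= ew fK.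
  have -> : w = idmap slice_data (lbl slice_data t s).1 (lbl slice_data t s).2 w'.
    by rewrite /= lst; apply: slice_inj; rewrite sval_idmap_tf //= ew fK.
  by apply: rst_sym; apply: rst_step; constructor => //=; rewrite lst.
- by have := odd_absz_succ e; rewrite (svalP s) (svalP t).
Qed.

Lemma place_inj u v : place u = place v -> glue_class slice_data u v.
Proof.
move=> e; have [lt|lt|ei] := ltgtP (copy_index u) (copy_index v).
- by apply: rst_sym; exact: glue_of_overlap.
- exact: glue_of_overlap.
have ep : copy_point u = copy_point v.
  apply: slice_inj; move: e; rewrite !placeE ei.
  exact: (iso_inj (zpow_iso gi gi' _)).
case: u v ei ep {e} => [[s w]|[s w]] [[t w']|[t w']] /= ei ->.
- by have -> : s = t by [apply: val_inj]; exact: rst_refl.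
- by have := svalP t; rewrite -ei (negbTE (svalP s)).
- by have := svalP t; rewrite -ei (svalP s).
- by have -> : s = t by [apply: val_inj]; exact: rst_refl.
Qed.

Definition unfold_map (a : amalgam slice_data) : G := place (sval (cid (svalP a))).

Lemma unfold_proj u : unfold_map (amalgam_proj slice_data u) = place u.
Proof.
rewrite /unfold_map; case: cid => v /= e; apply/esym/place_class.
by rewrite e; exact: rst_refl.
Qed.

Lemma unfold_mem (a : amalgam slice_data) u : sval a u -> unfold_map a = place u.
Proof. by rewrite /unfold_map; case: cid => v /= -> /place_class. Qed.

Lemma copy_at (n : int) : exists c : slice_graph -> copies,
  (forall w, place (c w) = zpow n (sval w)) /\
  forall w w', adj w w' -> copies_adj (c w) (c w').
Proof.
have [e|o] := boolP (odd `|n|%N).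
  by exists (fun w => inr (exist _ (n : double_ray) e : V2, w)).
by exists (fun w => inl (exist _ (n : double_ray) o : V1, w)).
Qed.

Lemma slice_point n x : slice (zpow (- n)%R x) ->
  exists w : slice_graph, zpow n (sval w) = x.
Proof. by move=> h; exists (exist _ _ h); rewrite /= zpowKN. Qed.

Lemma unfold_proj_eq u (a : amalgam slice_data) :
  place u = unfold_map a -> amalgam_proj slice_data u = a.
Proof.
move=> e; rewrite -[RHS](proj_rep a); apply: eq_exist.
have j : glue_class slice_data u (sval (cid (svalP a))) by exact: place_inj.
apply/seteqP; split=> v h; first exact: rst_trans (rst_sym _ _ _ _ j) h.
exact: rst_trans j h.
Qed.

Lemma unfold_iso : is_iso unfold_map.
Proof.
split.
  have inj : injective unfold_map.
    move=> a b e; rewrite -(unfold_proj_eq (u := sval (cid (svalP a))) e).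
    by rewrite proj_rep.
  have /choice[h hK] x : exists a, unfold_map a = x.
    have [n [b nb]] := level_exists x.
    have [w <-] := slice_point (slice_level b nb); have [c [pc _]] := copy_at n.
    by exists (amalgam_proj slice_data (c w)); rewrite unfold_proj pc.
  by exists h => // a; apply: inj; rewrite hK.
move=> a b; apply/idP/idP.
- move=> ab; have [n [/slice_point[w ew] /slice_point[w' ew']]] := adj_slice ab.
  have [c [pc ac]] := copy_at n; apply/asboolP; split.
    by move=> e; move: ab; rewrite e adj_irr.
  exists (c w), (c w'); split.
  + by rewrite -(unfold_proj_eq (u := c w) (a := a)) ?pc //; exact: rst_refl.
  + by rewrite -(unfold_proj_eq (u := c w') (a := b)) ?pc //; exact: rst_refl.
  + by apply: ac; rewrite /= /slice_adj -(zpow_iso gi gi' n).2 ew ew'.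
- move=> /asboolP[_ [u [v [/unfold_mem -> /unfold_mem ->]]]].
  by case: u v => [[s x]|[s x]] [[t y]|[t y]] //= -[-> xy]; rewrite (zpow_iso gi gi' _).2.
Qed.

Lemma slice_identifying : identifying_maps_identity unfold_map.
Proof.
move=> s t st k l.
have pt x : adh1 slice_data k x ->
    unfold_map (copy2 slice_data t (idmap slice_data k l x)) =
    unfold_map (copy1 slice_data s x).
  move=> Sx; rewrite !unfold_proj; apply/esym/place_glue.
  by constructor.
have [im _ sur] := idmap_bij slice_data k l.
split => //; apply/seteqP; split=> _ [x Sx <-].
  by exists (idmap slice_data k l x); [exact: im|exact: pt].
by have [y Sy <-] := sur _ Sx; exists y => //; rewrite /= -pt.
Qed.

Lemma slice_adh_finite k : finite_set (slice_adh k).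
Proof.
have fin (A : set G) : finite_set A -> finite_set [set x : slice_graph | A (sval x)].
  by move=> fA; apply: finite_preimage => // x y _ _ /slice_inj.
case: k; last exact: (fin S).
apply: (fin [set z | S (g' z)]); apply: (sub_finite_set _ (finite_image g finS)) => x Sx.
by exists (g' x).
Qed.

Lemma slice_joined A (x y : slice_graph) : A `<=` slice ->
  joined_in A (sval x) (sval y) ->
  joined_in [set z : slice_graph | A (sval z)] x y.
Proof.
move=> sub j.
suff h z : joined_in A (sval x) z -> forall sz : slice z,
    joined_in [set z : slice_graph | A (sval z)] x (exist _ z sz).
  by have := h _ j (svalP y); congr joined_in; exact: slice_inj.
move=> {}j; apply: (joined_ind (P := fun z => forall sz : slice z,
    joined_in [set z : slice_graph | A (sval z)] x (exist _ z sz)) j).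
  move=> sz; have -> : exist _ (sval x) sz = x by exact: slice_inj.
  by apply: joined_refl; exact: joined_l j.
move=> u v Au Av uv _ IH sz; apply: (joined_trans (IH (sub _ Au))).
exact: joined_adj.
Qed.

Lemma slice_adh_connected k : connected_set (slice_adh k).
Proof.
have [[s Ss] jS] := conS; case: k; split.
- have h : slice (g s) by apply: slice_gS; rewrite fK.
  by exists (exist _ (g s) h); rewrite /slice_adh /= fK.
- move=> x y Sx Sy; apply: (slice_joined (A := [set z | S (g' z)])).
    by move=> z; exact: slice_gS.
  have : joined_in S (g' (sval x)) (g' (sval y)) by exact: jS.
  move/(iso_joined gi); rewrite !gK; apply: joined_mono => _ [z Sz <-].
  by rewrite /= fK.
- by exists (exist _ s (slice_S Ss)).
- move=> x y Sx Sy; apply: (slice_joined (A := S)); first exact: slice_S.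
  exact: jS.
Qed.

Lemma slice_adh_disjoint : slice_adh false `&` slice_adh true = set0.
Proof.
apply/seteqP; split=> // x [/= Sx Sgx].
by have := Sg Sgx; rewrite gK => /(_ (SB Sx)).
Qed.

Definition slice_ends : set G := [set x | S x \/ S (g' x)].

(** A geodesic towards a translate of [S] meets one of the two ends of the slice
    before it can leave the slice, so its initial part bounds a distance within
    the slice. *)
Lemma walk_to_slice_ends n (x : slice_graph) k s : S s ->
  gdist (sval x) (zpow k s) = n ->
  exists (u : slice_graph) p, [/\ slice_ends (sval u), walk x u p & (size p <= n)%N].
Proof.
move=> Ss; elim: n x => [|n IH] x d;
  (have [Tx|nT] := pselect (slice_ends (sval x)); first by exists x, [::]).
- exfalso; apply: nT; have /= e := gdist0 cG d.
  have [lt|lt|e0] := ltgtP 0%R k.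
  + right; have [_ _ ->] := slice_overlap (slice_S Ss) (svalP x) lt (esym e).
    by rewrite fK.
  + by left; have [_] := slice_overlap (svalP x) (slice_S Ss) lt e.
  + by left; rewrite e -e0.
- have [z xz zy] := gdist_step cG d.
  have nBx : ~ B (sval x) by move=> /(svalP x).2 Sx; apply: nT; left.
  have sz : slice z.
    split; last by move=> Bz; apply: (bdB Bz nBx); rewrite adj_sym.
    apply: contrapT => nBz; apply: nT; right.
    by apply: (bdB (svalP x).1 nBz); rewrite gi'.2.
  have [u [p [Tu [wp lp] sp]]] := IH (exist _ z sz) zy.
  exists u, (exist _ z sz :: p); split => //; split => //=.
  by rewrite wp andbT.
Qed.

(** Take a walk from [S] to its image under [g]: after its last visit to [B] it
    runs in the slice until it meets that image. *)
Lemma slice_crossing : exists s s', [/\ S s, S (g' s') & joined_in slice s s'].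
Proof.
have [[s0 Ss0] _] := conS.
pose U := [set x | S (g' x)].
have US : ~ U s0 by move=> /Sg; rewrite gK => /(_ (SB Ss0)).
have Ugs : U (g s0) by rewrite /U /= fK.
have [z [z' [j zz' Uz']]] := first_hit cG US Ugs.
have nB' : ~ B z' by have := Sg Uz'; rewrite gK.
have : B z \/ exists s, [/\ S s, joined_in slice s z & ~ B z /\ B (g' z)].
  apply: (joined_ind (P := fun z => B z \/ exists s,
     [/\ S s, joined_in slice s z & ~ B z /\ B (g' z)]) j); first by left; exact: SB.
  move=> u v Uu Uv uv _ IH; have [Bv|nBv] := pselect (B v); [by left|right].
  have sv : B (g' v) -> slice v by move=> Bv; split.
  case: IH => [Bu|[s [Ss js [nBu Bu]]]].
    have Su := bdB Bu nBv uv; have Bv := neighbour_B uv Bu.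
    exists u; split => //; apply: joined_adj uv; [exact: slice_S|exact: sv].
  have Bv : B (g' v).
    by apply: contrapT => nb; apply: Uu; apply: (bdB Bu nb); rewrite gi'.2.
  by exists s; split => //; apply: (joined_trans js); apply: joined_adj.
case=> [Bz|[s [Ss js _]]].
  have Sz := bdB Bz nB' zz'; exists z, z'; split => //.
  by apply: joined_adj zz'; [exact: slice_S|exact: slice_gS].
exists s, z'; split => //; apply: (joined_trans js); apply: joined_adj => //.
  exact: joined_r js.
exact: slice_gS.
Qed.

Lemma slice_ends_joined : exists s : slice_graph, forall x : slice_graph,
  slice_ends (sval x) -> joined_in [set: slice_graph] s x.
Proof.
have [s [s' [Ss Ss' j]]] := slice_crossing.
pose a : slice_graph := exist _ s (slice_S Ss).
pose a' : slice_graph := exist _ s' (slice_gS Ss').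
have aa' : joined_in [set: slice_graph] a a'.
  by apply: joined_mono (slice_joined (x := a) (y := a') _ j).
exists a => x [Sx|Sx].
  by have [_ /(_ a x Ss Sx)] := slice_adh_connected false; exact: joined_mono.
apply: (joined_trans aa').
by have [_ /(_ a' x Ss' Sx)] := slice_adh_connected true; exact: joined_mono.
Qed.

Hypothesis no_ray : forall r, is_ray r -> ~ forall n, slice (r n).
Variable D : nat.
Hypothesis near : forall x, exists n s, S s /\ (gdist x (zpow n s) <= D)%N.

Lemma slice_connected : connected_graph slice_graph.
Proof.
have [s js] := slice_ends_joined.
have jx x : joined_in [set: slice_graph] s x.
  have [n [t [St _]]] := near (sval x).
  have [u [p [Tu wp _]]] := walk_to_slice_ends St (erefl (gdist (sval x) (zpow n t))).
  apply: joined_trans (js _ Tu) (joined_sym _); exists p => //.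
  by elim: (x :: p) => //= y q ->; rewrite andbT; exact: mem_set.
by split; [exists s|move=> x y _ _; apply: joined_trans (joined_sym (jx x)) (jx y)].
Qed.

(** All vertices are boundedly close, within the slice, to its two ends, which are
    finite. *)
Lemma slice_diameter : finite_diameter slice_graph.
Proof.
have c := slice_connected; have [[o _] _] := c.
have fT : finite_set (slice_adh false `|` slice_adh true).
  by rewrite finite_setU; split; exact: slice_adh_finite.
have [E HE] := finite_set_bounded_gdist o fT.
have h x : (gdist o x <= E + D)%N.
  have [n [t [St le]]] := near (sval x).
  have [u [p [Tu wp sp]]] := walk_to_slice_ends St (erefl (gdist (sval x) (zpow n t))).
  have := HE u Tu; have := gdist_le c wp; have := gdist_tri c u o x.
  by rewrite (gdist_sym c u x); lia.
exists ((E + D) + (E + D))%N => x y.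
have := gdist_tri c o x y; rewrite (gdist_sym c x o).
by have := h x; have := h y; lia.
Qed.

Lemma slice_rayless : rayless slice_graph.
Proof.
move=> r [inj ra]; apply: (no_ray (r := fun n => sval (r n))); last first.
  by move=> n; exact: svalP.
by split; [move=> m n /slice_inj/inj|exact: ra].
Qed.

Lemma slicing_splits : splits_strongly_thin G.
Proof.
exists slice_graph, slice_data, unfold_map; split.
- exact: unfold_iso.
- split; [split => k; exact: slice_adh_finite|exact: slice_rayless|exact: slice_rayless].
- split; [exact: slice_connected|exact: slice_rayless|exact: slice_diameter].
- exact: slice_identifying.
have adhE A : is_adhesion slice_data A -> exists k, A = slice_adh k.
  by case=> -[k _ <-]; exists k.
split; first by move=> A /adhE[k ->]; split; [exact: slice_adh_finite|exact: slice_adh_connected].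
split; [exact: slice_adh_disjoint|exact: slice_adh_disjoint|].
move=> A A' /adhE[k ->] /adhE[k' ->]; case: k k' => [] [] // _.
  by rewrite setIC; exact: slice_adh_disjoint.
exact: slice_adh_disjoint.
Qed.

End Slicing.

(** * Two-ended graphs *)

Section TwoEnds.
Context {G : graph} (cG : connected_graph G) (qt : quasi_transitive G)
  (nd : no_dominated_end G) (p q : nat -> G).
Hypotheses (py : is_ray p) (qy : is_ray q) (pq : ~ ray_equiv p q).
Hypothesis two : forall r, is_ray r -> ray_equiv p r \/ ray_equiv q r.
Implicit Types (S T U : set G) (h : G -> G).

Definition separator S :=
  [/\ finite_set S, connected_set S & forall x, reach S p x -> ~ reach S q x].

Lemma separator_exists : exists S, separator S.
Proof.
have [S [fS nS]] : exists S, finite_set S /\ ~ eventually_joined S p q.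
  apply: contrapT => nS; apply/pq/ray_equivP => // S fS.
  by apply: contrapT => nj; apply: nS; exists S.
have [S' [fS' cS' SS']] := finite_connected_hull cG fS.
exists S'; split => // x xp xq; apply/nS/eventually_joinedP => //.
by exists x; split; exact: reach_anti SS' _.
Qed.

Definition fixes_ends h := ray_equiv p (h \o p) /\ ray_equiv q (h \o q).
Definition swaps_ends h := ray_equiv q (h \o p) /\ ray_equiv p (h \o q).

Lemma fixes_or_swaps h : is_iso h -> fixes_ends h \/ swaps_ends h.
Proof.
move=> hi; have hp := iso_ray hi py; have hq := iso_ray hi qy.
have ne r : is_ray r -> ray_equiv r (h \o p) -> ~ ray_equiv r (h \o q).
  move=> y e e'; apply/pq/(iso_ray_equivE hi) => //.
  exact: ray_equiv_trans (ray_equiv_sym y hp e) e'.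
have [e1|e1] := two hp; have [e2|e2] := two hq.
- by case: (ne p).
- by left.
- by right.
- by case: (ne q).
Qed.

Lemma separator_image S h : is_iso h -> separator S -> separator (h @` S).
Proof.
move=> hi [fS cS sS]; have fhS : finite_set (h @` S) by exact: finite_image.
split => //; first exact: iso_connected_set.
move=> x xp xq; have hp := iso_ray hi py; have hq := iso_ray hi qy.
have [k [_ _ kh]] := iso_inv hi; rewrite -(kh x) in xp xq.
have [[e1 e2]|[e1 e2]] := fixes_or_swaps hi.
  apply: (sS (k x)); apply/(iso_reachE _ _ _ hi).
    exact: reach_equiv e1 xp.
  exact: reach_equiv e2 xq.
apply: (sS (k x)); apply/(iso_reachE _ _ _ hi).
  exact: reach_equiv e1 xq.
exact: reach_equiv e2 xp.
Qed.

(** As [p] leaves every ball, infinitely many vertices of [p] in one orbit give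
    automorphisms that move [S] as far along [p] as desired. *)
Lemma far_image S T : finite_set S -> finite_set T ->
  exists h, is_iso h /\ h @` S `<=` reach T p.
Proof.
move=> fS fT; have [i Hi] := orbit_recurrence p qt.
have [D HD] := finite_set_bounded_gdist (p i) fS.
have [E HE] := finite_set_bounded_gdist (p i) fT.
have [N HN] := ray_leaves_ball cG (p i) (E + D) nd py.
have [M HM] := reach_tail py fT.
have [n [h [le hi e]]] := Hi (maxn N M).
exists h; split => // _ [s Ss <-].
apply: (reach_joined (y := p n)); last by apply: HM; lia.
apply: (geodesic_joined cG) => z; rewrite -{2}e (gdist_iso cG cG hi) => lz Tz.
have := HD s Ss; have := HE z Tz; have := HN n; have := gdist_tri cG z (p i) (p n).
by rewrite (gdist_sym cG s) in lz *; lia.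
Qed.

(** If [S] met the side of [T] that contains a tail of [p], then both possible
    first encounters of a walk from a tail of [q] with the two sets would be
    absurd: from [S], which is connected and disjoint from [T], the walk could be
    continued to [p] avoiding [T], and from [T] to [p] avoiding [S]. *)
Lemma separators_nested S T : separator S -> separator T -> T `<=` reach S p ->
  (forall s, S s -> ~ reach T p s) /\ reach T p `<=` reach S p.
Proof.
move=> [fS cS sS] [fT cT sT] TS.
have dis x : S x -> ~ T x by move=> Sx /TS/reach_notin.
have notin s : S s -> ~ reach T p s.
  move=> Ss ps.
  have [N HN] := reach_tail qy fS; have [M HM] := reach_tail qy fT.
  pose n := maxn N M.
  have qS : reach S q (q n) by apply: HN; lia.
  have qT : reach T q (q n) by apply: HM; lia.
  have qU : ~ (S `|` T) (q n) by case; [exact: reach_notin qS|exact: reach_notin qT].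
  have [z [z' [j zz' Uz']]] := first_hit cG qU (or_introl Ss : (S `|` T) s).
  have sub (A : set G) : A `<=` S `|` T -> ~ A z' -> joined_in (~` A) (q n) z'.
    move=> AU nA; have jA : joined_in (~` A) (q n) z.
      by apply: joined_mono j => y nU Ay; exact/nU/AU.
    by apply: (joined_trans jA); apply: joined_adj zz' => //; exact: joined_r jA.
  case: Uz' => [Sz'|Tz'].
    have jT : joined_in (~` T) (q n) s.
      apply: (joined_trans (sub T _ (dis _ Sz'))); first by right.
      apply: joined_mono (cS.2 _ _ Sz' Ss); exact: dis.
    exact: sT (reach_joined jT ps) qT.
  have nSz' : ~ S z' by move=> /dis.
  apply: sS (reach_joined (sub S _ nSz') (TS _ Tz')) qS; first by left.
split => // x px; have [N HN] := px.
exists N => n /HN/joined_self; apply: joined_mono => y xy Sy; apply: (notin y Sy).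
exact: reach_joined (joined_sym xy) px.
Qed.

(** Some automorphism fixes both ends and moves a separator beyond itself: if
    two automorphisms exchange the ends, then the quotient of the two fixes
    them. *)
Lemma translation_exists : exists S g,
  [/\ separator S, is_iso g, fixes_ends g & g @` S `<=` reach S p].
Proof.
have [S sS] := separator_exists; have [fS _ _] := sS.
have [h1 [i1 H1]] := far_image fS fS.
have s1 := separator_image i1 sS; have [f1 _ _] := s1.
have [h2 [i2 H2]] := far_image fS f1.
have [_ nest] := separators_nested sS s1 H1.
have [fix1|sw1] := fixes_or_swaps i1; first by exists S, h1.
have [fix2|sw2] := fixes_or_swaps i2.
  by exists S, h2; split => // x /H2/nest.
have [k [ki hk kh]] := iso_inv i1.
have gi : is_iso (h2 \o k) := iso_comp i2 ki.
exists (h1 @` S), (h2 \o k); split => //; last first.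
  by move=> _ [_ [x Sx <-] <-]; apply: H2; exists x => //=; rewrite hk.
have [//|[e1 e2]] := fixes_or_swaps gi.
have hp := iso_ray i1 py.
have e3 := iso_ray_equiv gi qy hp sw1.1.
have e4 : ray_equiv (h2 \o k \o q) (h2 \o p).
  by move: e3; congr ray_equiv; apply/funext => n /=; rewrite hk.
exfalso; apply: pq.
have gq := iso_ray gi qy; have h2p := iso_ray i2 py.
have e5 := ray_equiv_trans py gq h2p e2 e4.
exact: ray_equiv_trans e5 (ray_equiv_sym qy h2p sw2.1).
Qed.

(** If [T] meets neither [U] nor the side of [U] containing a tail of [r], then
    walking from that tail to [U] avoids [T]. *)
Lemma reach_past T U r : is_ray r -> finite_set T -> finite_set U -> U !=set0 ->
  (forall t, T t -> ~ U t) -> (forall t, T t -> ~ reach U r t) ->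
  exists2 u, U u & reach T r u.
Proof.
move=> y fT fU [u Uu] TU Tr.
have [N HN] := reach_tail y fT; have [M HM] := reach_tail y fU.
pose n := maxn N M.
have rT : reach T r (r n) by apply: HN; lia.
have rU : reach U r (r n) by apply: HM; lia.
have [z [z' [j zz' Uz']]] := first_hit cG (reach_notin rU) Uu.
exists z' => //; apply: reach_joined rT; apply: joined_sym.
have jT : joined_in (~` T) (r n) z.
  apply: joined_mono (joined_self j) => x xj Tx; apply: (Tr x Tx).
  exact: reach_joined (joined_sym xj) rU.
apply: (joined_trans jT); apply: joined_adj zz'; first exact: joined_r jT.
by move=> /TU.
Qed.

Variables (S : set G) (g g' : G -> G).
Hypotheses (sS : separator S) (gi : is_iso g) (gi' : is_iso g').
Hypotheses (fK : cancel g g') (gK : cancel g' g).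
Hypotheses (fixg : fixes_ends g) (gS : g @` S `<=` reach S p).

Local Notation zpow := (zpow g g').
Local Notation B := (~` reach S p).

Lemma B_boundary x y : B x -> ~ B y -> adj x y -> S x.
Proof.
move=> Bx /contrapT py' xy; apply: contrapT => nS; apply: Bx.
by apply: (reach_joined _ py'); apply: joined_adj xy => //; exact: reach_notin py'.
Qed.

Lemma reach_zpow n x : reach (zpow n @` S) p (zpow n x) <-> reach S p x.
Proof.
have fix_zpow m : ray_equiv p (zpow m \o p).
  have g'p : ray_equiv p (g' \o p).
    apply/(iso_ray_equivE gi) => //; first exact: iso_ray.
    have -> : g \o (g' \o p) = p by apply/funext => k /=; rewrite gK.
    by apply: ray_equiv_sym fixg.1 => //; exact: iso_ray.
  have step h k : is_iso h -> ray_equiv p (h \o p) -> ray_equiv p (iter k h \o p).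
    move=> hi e; elim: k => [|k IH]; first exact: ray_equiv_refl.
    have ki := iso_iter k hi.
    apply: (ray_equiv_trans py (iso_ray hi py)) e _ => //.
      exact: (iso_ray hi (iso_ray ki py)).
    exact: (iso_ray_equiv hi py (iso_ray ki py) IH).
  by case: m => k; [exact: (step g k gi fixg.1)|exact: (step g' k.+1 gi' g'p)].
have zi := zpow_iso gi gi' n; have zp := iso_ray zi py.
have fz : finite_set (zpow n @` S) by case: sS => fS _ _; exact: finite_image.
split=> [h|h]; first by apply/(iso_reachE _ _ _ zi); exact: reach_equiv h.
apply: (reach_equiv zp py fz (ray_equiv_sym py zp (fix_zpow n))).
exact/iso_reachE.
Qed.

Lemma B_shift x : B x -> B (g' x).
Proof.
move=> Bx px; apply: Bx.
have [_] := separators_nested sS (separator_image gi sS) gS; apply.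
by have := (reach_zpow 1%R (g' x)).2 px; rewrite /= gK.
Qed.

Lemma B_separator : S `<=` B.
Proof. by move=> x Sx /reach_notin. Qed.

Lemma S_shift x : S x -> ~ B (g x).
Proof. by move=> Sx; apply; apply: gS; exists x. Qed.

(** A ray in the slice would belong to one of the two ends, but the image of [S]
    separates it from [p] and [S] separates it from [q]. *)
Lemma slice_no_ray r : is_ray r -> ~ forall n, slice g' B S (r n).
Proof.
move=> y sl; have [fS _ sepS] := sS.
have [e|e] := two y.
  have fgS : finite_set (g @` S) by exact: finite_image.
  have [N HN] := reach_tail y fgS.
  have h := reach_equiv y py fgS (ray_equiv_sym py y e) (HN N (leqnn N)).
  have [+ _] := sl N; apply; apply/(reach_zpow 1%R); rewrite /= gK; exact: h.
have [N HN] := reach_tail y fS.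
have h := HN N (leqnn N).
have nB : ~ B (r N) by move=> /(sl N).2; exact: reach_notin h.
move: nB => /contrapT /sepS; apply.
exact: reach_equiv (ray_equiv_sym qy y e) h.
Qed.

(** Every vertex [x] lies close to some image [T] of the separator. This image
    meets a fixed neighbourhood of the translates of [S], for otherwise it would
    lie between two consecutive translates, which are joined within that
    neighbourhood, and so it would not separate the ends. *)
Lemma near_translates : exists D, forall x, exists n s,
  S s /\ (gdist x (zpow n s) <= D)%N.
Proof.
have [fS cS sepS] := sS; have [[s0 Ss0] jS] := cS.
have [X fX HX] := orbit_representatives qt.
have [D1 HD1] := finite_set_bounded_gdist s0 fS.
have [D2 HD2] := finite_set_bounded_gdist s0 fX.
pose L0 := gdist s0 (g s0).
pose L := [set y | exists n s, S s /\ (gdist y (zpow n s) <= L0)%N].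
exists (D2 + D1 + L0)%N => x; have [x0 [h [Xx0 hi hx]]] := HX x.
pose T := h @` S.
have [[t [Tt [n [s [Ss le]]]]]|TL] := pselect (exists t, T t /\ L t).
  exists n, s; split => //; case: Tt le => s1 Ss1 <- le.
  have := gdist_tri cG (h s1) x (zpow n s).
  rewrite -{2}hx (gdist_iso cG cG hi).
  have := gdist_tri cG s0 x0 s1; rewrite (gdist_sym cG x0 s0).
  by have := HD1 _ Ss1; have := HD2 _ Xx0; lia.
exfalso.
have sT : separator T := separator_image hi sS; have [fT [[t0 Tt0] jT] sepT] := sT.
have LS n s : S s -> L (zpow n s) by move=> Ss; exists n, s; rewrite (gdistxx cG).
have TS n t : T t -> ~ (zpow n @` S) t.
  by move=> Tt [s Ss e]; apply: TL; exists t; split => //; rewrite -e; exact: LS.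
have zi n : is_iso (zpow n) := zpow_iso gi gi' n.
have belowE n t : below g g' B n t <-> ~ reach (zpow n @` S) p t.
  by rewrite /below -{2}(zpowKN fK gK n t); split=> h1 /reach_zpow.
have exits n u v : T u -> below g g' B n u -> adj u v -> below g g' B n v.
  move=> Tu bu uv; apply: contrapT => nbv; apply: (TS n u Tu).
  exists (zpow (- n)%R u); last by rewrite zpowKN.
  by apply: (B_boundary bu nbv); rewrite (zi _).2.
have [n [b0 nb0]] := level_exists cG gi gi' fK gK cS B_separator B_boundary B_shift
  S_shift t0.
have lev t : T t -> below g g' B (n + 1)%R t /\ ~ below g g' B n t.
  move=> Tt; apply: (joined_ind (P := fun t => below g g' B (n + 1)%R t /\
    ~ below g g' B n t) (jT _ _ Tt0 Tt)) => // u v Tu Tv uv _ [bu nbu]; split.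
    exact: exits bu uv.
  by move=> bv; apply: nbu; apply: (exits n v u Tv bv); rewrite adj_sym.
have sep m := separator_image (zi m) sS.
have ne m : zpow m @` S !=set0 by exists (zpow m s0), s0.
have fin m : finite_set (zpow m @` S) by case: (sep m).
have [_ [s Ss <-] ps] : exists2 u, (zpow (n + 1)%R @` S) u & reach T p u.
  by apply: reach_past => // t Tt; [exact: TS|have [/belowE] := lev t Tt].
have [_ [s' Ss' <-] qs] : exists2 u, (zpow n @` S) u & reach T q u.
  apply: reach_past => // t Tt; first exact: TS.
  have [_ nb] := lev t Tt; have [_ _ /(_ t)] := sep n; apply.
  by apply: contrapT => nr; apply: nb; apply/belowE.
have LT : L `<=` ~` T by move=> y Ly Ty; apply: TL; exists y.
have jz m a b : S a -> S b -> joined_in (~` T) (zpow m a) (zpow m b).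
  move=> Sa Sb; apply: joined_mono (iso_joined (zi m) (jS _ _ Sa Sb)).
  by move=> _ [y Sy <-]; apply/LT/LS.
have step : joined_in (~` T) (zpow n s0) (zpow (n + 1)%R s0).
  rewrite (zpowD fK gK); apply: (geodesic_joined cG) => z; rewrite (gdist_iso cG cG (zi n)) => le.
  apply: LT; exists n, s0; split => //; rewrite (gdist_sym cG).
  by move: le; rewrite -/L0; lia.
have j : joined_in (~` T) (zpow n s') (zpow (n + 1)%R s).
  by apply: joined_trans (jz n _ _ Ss' Ss0) (joined_trans step (jz _ _ _ Ss0 Ss)).
exact: sepT (reach_joined j ps) qs.
Qed.

End TwoEnds.

Lemma two_ended_splits (G : graph) : connected_graph G -> quasi_transitive G ->
  no_dominated_end G -> two_ended G -> splits_strongly_thin G.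
Proof.
move=> cG qt nd /two_endedP[p [q [py qy pq two]]].
have [S [g [sS gi fixg gS]]] := translation_exists cG qt nd py qy pq two.
have [g' [gi' fK gK]] := iso_inv gi.
have [D near] := near_translates cG qt py qy pq two sS gi gi' fK gK fixg gS.
have [fS cS _] := sS.
apply: (slicing_splits cG gi gi' fK gK fS cS (B := ~` reach S p) _ _ _ _ _ near).
- exact: B_separator.
- exact: B_boundary.
- exact: (B_shift cG py qy pq two sS gi gi' gK fixg gS).
- exact: S_shift gS.
- exact: (slice_no_ray py qy two sS gi gi' gK fixg).
Qed.

(** * The three equivalent conditions *)

Theorem theorem3p1 (R : realType) (G : graph) :
  connected_graph G -> quasi_transitive G -> no_dominated_end G ->
  (two_ended G <-> splits_strongly_thin G) /\
  (splits_strongly_thin G <-> quasi_isometric R G double_ray).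
Proof.
move=> cG qt nd.
have i_ii := @two_ended_splits G cG qt nd.
have ii_iii : splits_strongly_thin G -> quasi_isometric R G double_ray.
  by move=> /(splitting_coarse_line cG)/quasi_isometric_double_ray.
have iii_i : quasi_isometric R G double_ray -> two_ended G.
  move=> /quasi_isometric_double_ray[phi [A q]].
  exact: coarse_line_two_ended q qt nd.
split; split; [exact: i_ii| |exact: ii_iii| ].
  by move=> /ii_iii/iii_i.
by move=> /iii_i/i_ii.
Qed.
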